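(* Let $A$ be a unitary ring. There is a bijection between equivalence classes of recollements of $\mathrm{Mod}\text{-}A$, TTF-triples in $\mathrm{Mod}\text{-}A$ and idempotent ideals of $A$.
   Context: $\mathrm{Mod}\text{-}A$ denotes the category of right $A$-modules. An idempotent ideal is a two-sided ideal $I$ with $I^2=I$. All subcategories are strict (closed under isomorphisms). $\operatorname{Im}F$ denotes the essential image of a functor $F$ and $\operatorname{Ker}F$ the full subcategory of objects sent to zero. A recollement $\mathsf{R}(\mathscr B,\mathscr A,\mathscr C)$ of an abelian category $\mathscr A$ by abelian categories $\mathscr B$ and $\mathscr C$ consists of additive functors $i_*\colon\mathscr B\to\mathscr A$, $i^*,i^!\colon\mathscr A\to\mathscr B$, $j^*\colon\mathscr A\to\mathscr C$, $j_!,j_*\colon\mathscr C\to\mathscr A$ such that: (1) $(j_!,j^*,j_* )$ and $(i^*,i_*,i^!)$ are adjoint triples (each functor is left adjoint to the next); (2) $i_*$, $j_!$ and $j_*$ are fully faithful; (3) $\operatorname{Im} i_*=\operatorname{Ker} j^*$. A recollement of $\mathrm{Mod}\text{-}A$ is one with $\mathscr A=\mathrm{Mod}\text{-}A$. Two recollements $\mathsf{R}(\mathscr B,\mathscr A,\mathscr C)$ and $\mathsf{R}(\mathscr B',\mathscr A',\mathscr C')$ are equivalent if there are equivalences of categories $\Phi\colon\mathscr A\to\mathscr A'$ and $\Theta\colon\mathscr C\to\mathscr C'$ such that $\Theta j^*$ is naturally equivalent to $j^{*\prime}\Phi$, where $j^{*\prime}\colon\mathscr A'\to\mathscr C'$ is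 the functor of the second recollement corresponding to $j^*$. A torsion pair in an abelian category $\mathscr A$ is a pair $(\mathcal T,\mathcal F)$ of full subcategories such that $\operatorname{Hom}_{\mathscr A}(T,F)=0$ for all $T\in\mathcal T$, $F\in\mathcal F$, and every object $M$ of $\mathscr A$ admits a short exact sequence $0\to T_M\to M\to F^M\to 0$ with $T_M\in\mathcal T$, $F^M\in\mathcal F$. A TTF-triple in $\mathscr A$ is a triple $(\mathcal X,\mathcal Y,\mathcal Z)$ of full subcategories such that $(\mathcal X,\mathcal Y)$ and $(\mathcal Y,\mathcal Z)$ are torsion pairs.
   Formalization: Equivalence of recollements of Mod-A is taken with Φ naturally isomorphic to the identity of Mod-A; with arbitrary Φ the claim fails, e.g. for A = F_2 × F_2 (four idempotent ideals, but swapping the factors leaves only three classes). *)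

(* Defs.v *)
From HB Require Import structures.
From mathcomp Require Import all_boot all_algebra.
From mathcomp Require Import boolp.

Set Implicit Arguments.
Unset Strict Implicit.
Unset Printing Implicit Defensive.

Import GRing.Theory.
Local Open Scope ring_scope.

Declare Scope cat_scope.
Delimit Scope cat_scope with cat.

(* [category] means preadditive category; morphisms are compared with Leibniz
   equality. *)
Record category := Category {
  ob :> Type;
  mor : ob -> ob -> zmodType;
  idm : forall X, mor X X;
  mcomp : forall X Y Z, mor Y Z -> mor X Y -> mor X Z;
  mcomp1m : forall X Y (f : mor X Y), mcomp (idm Y) f = f;
  mcompm1 : forall X Y (f : mor X Y), mcomp f (idm X) = f;
  mcompA : forall W X Y Z (h : mor Y Z) (g : mor X Y) (f : mor W X),
    mcomp h (mcomp g f) = mcomp (mcomp h g) f;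
  mcompDl : forall X Y Z (g h : mor Y Z) (f : mor X Y),
    mcomp (g + h) f = mcomp g f + mcomp h f;
  mcompDr : forall X Y Z (g : mor Y Z) (f h : mor X Y),
    mcomp g (f + h) = mcomp g f + mcomp g h }.

Arguments idm {c} X.
Notation "g \c f" := (mcomp g f) (at level 40, left associativity) : cat_scope.
Local Open Scope cat_scope.

Section Notions.
Variable C : category.
Implicit Types X Y Z : C.

Definition is_iso X Y (f : mor X Y) : Prop :=
  exists g : mor Y X, g \c f = idm X /\ f \c g = idm Y.

Definition iso X Y : Prop := exists f : mor X Y, is_iso f.

Definition is_zero Z : Prop :=
  (forall X, exists! f : mor X Z, True) /\ (forall X, exists! f : mor Z X, True).

Definition mono X Y (f : mor X Y) : Prop :=
  forall W (g h : mor W X), f \c g = f \c h -> g = h.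

Definition epi X Y (f : mor X Y) : Prop :=
  forall W (g h : mor Y W), g \c f = h \c f -> g = h.

Definition is_kernel K X Y (k : mor K X) (f : mor X Y) : Prop :=
  f \c k = 0 /\
  forall W (g : mor W X), f \c g = 0 -> exists! h : mor W K, k \c h = g.

Definition is_cokernel X Y Q (q : mor Y Q) (f : mor X Y) : Prop :=
  q \c f = 0 /\
  forall W (g : mor Y W), g \c f = 0 -> exists! h : mor Q W, h \c q = g.

Definition is_biproduct X Y P (i1 : mor X P) (i2 : mor Y P)
    (p1 : mor P X) (p2 : mor P Y) : Prop :=
  [/\ p1 \c i1 = idm X, p2 \c i2 = idm Y, p1 \c i2 = 0, p2 \c i1 = 0
    & i1 \c p1 + i2 \c p2 = idm P].

Definition short_exact X Y Z (f : mor X Y) (g : mor Y Z) : Prop :=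
  is_kernel f g /\ is_cokernel g f.

Record abelian : Prop := Abelian {
  ab_zero : exists Z, is_zero Z;
  ab_biproduct : forall X Y, exists P i1 i2 p1 p2,
    @is_biproduct X Y P i1 i2 p1 p2;
  ab_kernel : forall X Y (f : mor X Y), exists K (k : mor K X), is_kernel k f;
  ab_cokernel : forall X Y (f : mor X Y), exists Q (q : mor Y Q), is_cokernel q f;
  ab_mono : forall X Y (f : mor X Y), mono f ->
    exists Z (g : mor Y Z), is_kernel f g;
  ab_epi : forall X Y (f : mor X Y), epi f ->
    exists W (g : mor W X), is_cokernel f g }.

Definition strict (S : C -> Prop) : Prop := forall X Y, iso X Y -> S X -> S Y.

Record torsion_pair (T F : C -> Prop) : Prop := TorsionPair {
  tp_strictl : strict T;
  tp_strictr : strict F;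
  tp_hom0 : forall X Y, T X -> F Y -> forall f : mor X Y, f = 0;
  tp_exact : forall M, exists TM FM (i : mor TM M) (p : mor M FM),
    [/\ T TM, F FM & short_exact i p] }.

Record ttf_triple := TTFTriple {
  ttf_X : C -> Prop;
  ttf_Y : C -> Prop;
  ttf_Z : C -> Prop;
  ttf_XY : torsion_pair ttf_X ttf_Y;
  ttf_YZ : torsion_pair ttf_Y ttf_Z }.

End Notions.

(* Functors are not required to be additive; see [additive_functor]. *)
Record functor (C D : category) := Functor {
  fob :> C -> D;
  fmap : forall X Y, mor X Y -> mor (fob X) (fob Y);
  fmap1 : forall X, fmap (idm X) = idm (fob X);
  fmapM : forall X Y Z (g : mor Y Z) (f : mor X Y),
    fmap (g \c f) = fmap g \c fmap f }.

Definition id_functor (C : category) : functor C C :=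
  @Functor C C id (fun X Y f => f) (fun X => erefl) (fun X Y Z g f => erefl).

Program Definition comp_functor (C D E : category)
    (G : functor D E) (F : functor C D) : functor C E :=
  @Functor C E (fun X => G (F X)) (fun X Y f => fmap G (fmap F f)) _ _.
Next Obligation. by rewrite !fmap1. Qed.
Next Obligation. by rewrite !fmapM. Qed.
Notation "G \F F" := (comp_functor G F)
  (at level 40, left associativity) : cat_scope.

Definition nat_iso (C D : category) (F G : functor C D) : Prop :=
  exists eta : forall X, mor (F X) (G X),
    (forall X, is_iso (eta X)) /\
    (forall X Y (f : mor X Y), fmap G f \c eta X = eta Y \c fmap F f).

Definition equivalence (C D : category) (F : functor C D) : Prop :=
  exists G : functor D C,
    nat_iso (G \F F) (id_functor C) /\ nat_iso (F \F G) (id_functor D).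

Definition additive_functor (C D : category) (F : functor C D) : Prop :=
  forall X Y (f g : mor X Y), fmap F (f + g) = fmap F f + fmap F g.

Definition fully_faithful (C D : category) (F : functor C D) : Prop :=
  forall X Y, bijective (@fmap C D F X Y).

Definition left_adjoint (C D : category) (L : functor C D) (R : functor D C) :
    Prop :=
  exists phi : forall X Y, mor (L X) Y -> mor X (R Y),
    (forall X Y, bijective (phi X Y)) /\
    (forall X X' Y Y' (f : mor X' X) (g : mor Y Y') (h : mor (L X) Y),
      phi X' Y' (g \c h \c fmap L f) = fmap R g \c phi X Y h \c f).

Definition ess_image (C D : category) (F : functor C D) : D -> Prop :=
  fun Y => exists X, iso (F X) Y.

Definition ker_functor (C D : category) (F : functor C D) : C -> Prop :=
  fun X => is_zero (F X).

(* Only the two outer terms are asserted to be abelian: the middle one is fixed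
   beforehand, and it is a module category in the application. *)
Record recollement (A : category) := Recollement {
  rB : category;
  rC : category;
  rB_abelian : abelian rB;
  rC_abelian : abelian rC;
  i_lstar : functor rB A;
  i_ustar : functor A rB;
  i_ushriek : functor A rB;
  j_ustar : functor A rC;
  j_lshriek : functor rC A;
  j_lstar : functor rC A;
  i_lstar_additive : additive_functor i_lstar;
  i_ustar_additive : additive_functor i_ustar;
  i_ushriek_additive : additive_functor i_ushriek;
  j_ustar_additive : additive_functor j_ustar;
  j_lshriek_additive : additive_functor j_lshriek;
  j_lstar_additive : additive_functor j_lstar;
  adj_j_lshriek_ustar : left_adjoint j_lshriek j_ustar;
  adj_j_ustar_lstar : left_adjoint j_ustar j_lstar;
  adj_i_ustar_lstar : left_adjoint i_ustar i_lstar;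
  adj_i_lstar_ushriek : left_adjoint i_lstar i_ushriek;
  i_lstar_ff : fully_faithful i_lstar;
  j_lshriek_ff : fully_faithful j_lshriek;
  j_lstar_ff : fully_faithful j_lstar;
  im_i_ker_j : forall X : A, ess_image i_lstar X <-> ker_functor j_ustar X }.

(* [recollement_equiv_via Phi R R']: R and R' are equivalent, the equivalence
   of the middle terms being Phi. *)
Definition recollement_equiv_via (A A' : category) (Phi : functor A A')
    (R : recollement A) (R' : recollement A') : Prop :=
  equivalence Phi /\
  exists Theta : functor (rC R) (rC R'),
    equivalence Theta /\ nat_iso (Theta \F j_ustar R) (j_ustar R' \F Phi).

(* Equivalence of recollements of one fixed category A: the equivalence
   A -> A is the identity up to natural isomorphism. An arbitrary
   autoequivalence of A would be too coarse: for A = Mod-(k x k), swapping the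
   two factors carries the recollement of the ideal k x 0 to that of 0 x k. *)
Definition recollement_equiv (A : category) (R R' : recollement A) : Prop :=
  exists Phi : functor A A,
    nat_iso Phi (id_functor A) /\ recollement_equiv_via Phi R R'.

Definition recollement_class (A : category) : Type :=
  {P : recollement A -> Prop |
    exists R, forall S, P S <-> recollement_equiv R S}.

(* Right A-modules are left modules over the converse ring A^c. *)
Section ModCategory.
Variable A : pzRingType.

Definition mod_hom (M N : lmodType A^c) : Type := {linear M -> N}.

(* The choice structure that zmodType demands comes from classical choice. *)
Section ModHom.
Variables M N : lmodType A^c.

HB.instance Definition _ := gen_eqMixin (mod_hom M N).
HB.instance Definition _ := gen_choiceMixin (mod_hom M N).

Definition mod_hom_zero : mod_hom M N := \0 : {linear M -> N}.
Definition mod_hom_opp (f : mod_hom M N) : mod_hom M N :=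
  (\- (f : {linear M -> N}))%R : {linear M -> N}.
Definition mod_hom_add (f g : mod_hom M N) : mod_hom M N :=
  ((f : {linear M -> N}) \+ (g : {linear M -> N}))%R : {linear M -> N}.

Lemma mod_homP (f g : mod_hom M N) :
  (forall x, (f : {linear M -> N}) x = (g : {linear M -> N}) x) -> f = g.
Proof.
case: f g => [f cf] [g cg] /= fg; have {}fg : f = g by apply/funext.
case: _ / fg in cg *; congr GRing.Linear.Pack.
case: cf cg => [[a] [b]] [[a'] [b']].
by rewrite (Prop_irrelevance a a') (Prop_irrelevance b b').
Qed.

Fact mod_hom_addA : associative mod_hom_add.
Proof. by move=> f g h; apply: mod_homP => x /=; rewrite addrA. Qed.
Fact mod_hom_addC : commutative mod_hom_add.
Proof. by move=> f g; apply: mod_homP => x /=; rewrite addrC. Qed.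
Fact mod_hom_add0 : left_id mod_hom_zero mod_hom_add.
Proof. by move=> f; apply: mod_homP => x /=; rewrite add0r. Qed.
Fact mod_hom_addN : left_inverse mod_hom_zero mod_hom_opp mod_hom_add.
Proof. by move=> f; apply: mod_homP => x /=; rewrite addNr. Qed.

HB.instance Definition _ := GRing.isZmodule.Build (mod_hom M N)
  mod_hom_addA mod_hom_addC mod_hom_add0 mod_hom_addN.

End ModHom.

Definition mod_id (M : lmodType A^c) : mod_hom M M := idfun : {linear M -> M}.

Definition mod_comp (M N P : lmodType A^c) (g : mod_hom N P)
    (f : mod_hom M N) : mod_hom M P :=
  ((g : {linear N -> P}) \o (f : {linear M -> N})) : {linear M -> P}.

Program Definition Mod : category :=
  @Category (lmodType A^c) (fun M N => mod_hom M N) mod_id mod_comp _ _ _ _ _.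
Next Obligation. by apply: mod_homP. Qed.
Next Obligation. by apply: mod_homP. Qed.
Next Obligation. by apply: mod_homP. Qed.
Next Obligation. by apply: mod_homP. Qed.
Next Obligation. by apply: mod_homP => x /=; rewrite linearD. Qed.

End ModCategory.

(* The product of two ideals: finite sums of products x * y. *)
Definition ideal_mul (A : pzRingType) (I J : A -> Prop) : A -> Prop :=
  fun a => exists n (x y : 'I_n -> A),
    (forall k, I (x k) /\ J (y k)) /\ a = \sum_(k < n) x k * y k.

Record two_sided_ideal (A : pzRingType) (I : A -> Prop) : Prop := TwoSidedIdeal {
  ideal0 : I 0;
  idealD : forall x y, I x -> I y -> I (x + y);
  idealMl : forall a x, I x -> I (a * x);
  idealMr : forall x a, I x -> I (x * a) }.

Record idempotent_ideal (A : pzRingType) := IdempotentIdeal {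
  ideal_set :> A -> Prop;
  ideal_two_sided : two_sided_ideal ideal_set;
  ideal_idem : forall a, ideal_mul ideal_set ideal_set a <-> ideal_set a }.

(* Main.v *)
(** An idempotent ideal [I] gives the TTF-triple of the modules [M] with
    [M I = M], with [M I = 0], and without nonzero elements killed by [I];
    conversely the middle class [Y] of a TTF-triple is closed under quotients,
    sums and extensions and contains [A / ann Y], which forces
    [Y = {M | M (ann Y) = 0}] and [ann Y] idempotent.  The same argument applies
    to [Y = Ker j^*] for a recollement.  Two recollements with the same
    [Ker j^*] are equivalent through [j'^* j_!], because [j^*] and [j'^*] are
    exact and so invert the same morphisms.  A recollement realizing [I] has for
    [C] the modules [W] such that [W -> Hom_A(I, W)] is bijective: [j_*] is the
    inclusion, [j^*] the reflection [M |-> Hom_A(I, M / {m | m I = 0})], and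
    [j_! N = N I (x)_A I]. *)

From HB Require Import structures.
From mathcomp Require Import all_boot all_algebra boolp.
Require Import Defs.

Set Implicit Arguments.
Unset Strict Implicit.
Unset Printing Implicit Defensive.

Import GRing.Theory.
Local Open Scope ring_scope.
Local Open Scope cat_scope.

(** * Preadditive categories and adjunctions *)

(** Idempotence of an ideal and closure of its killed modules under extensions are two sides of one
    fact. It is read off from [A / J^2], for [J] the annihilator of the middle class, and it is used
    backwards in the forms [M I I = M I] and [m I I = 0] implies [m I = 0]. The category [C] stands
    for the quotient of [Mod A] by the modules killed by [I], where a map with killed kernel and
    cokernel becomes invertible. Taking local modules as objects keeps morphisms plain linear maps,
    at a price: cokernels and epimorphisms in [C] are not those of modules, so that abelianness has
    to be checked by hand, and [j_!] has to invert maps whose kernel and cokernel are merely killed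
    by [I]. *)

Section Preadditive.
Variable C : category.
Implicit Types X Y Z W : C.

Lemma mcomp0r X Y Z (g : mor Y Z) : g \c (0 : mor X Y) = 0.
Proof. by apply: (addrI (g \c 0)); rewrite -mcompDr !addr0. Qed.

Lemma mcomp0l X Y Z (f : mor X Y) : (0 : mor Y Z) \c f = 0.
Proof. by apply: (addrI (0 \c f)); rewrite -mcompDl !addr0. Qed.

Lemma mcompBr X Y Z (g : mor Y Z) (f h : mor X Y) :
  g \c (f - h) = g \c f - g \c h.
Proof. by apply/eqP; rewrite eq_sym subr_eq -mcompDr subrK. Qed.

Lemma mcompBl X Y Z (g h : mor Y Z) (f : mor X Y) :
  (g - h) \c f = g \c f - h \c f.
Proof. by apply/eqP; rewrite eq_sym subr_eq -mcompDl subrK. Qed.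

Lemma is_zeroP Z : is_zero Z <-> idm Z = 0.
Proof.
split=> [[toZ _]|Z0].
  by have [f [_ fE]] := toZ Z; rewrite -(fE (idm Z) I) -(fE 0 I).
split=> X; exists 0; split=> // f _.
  by rewrite -(mcomp1m f) Z0 mcomp0l.
by rewrite -(mcompm1 f) Z0 mcomp0r.
Qed.

Lemma mor_to_zero X Z (f : mor X Z) : is_zero Z -> f = 0.
Proof. by move=> /is_zeroP Z0; rewrite -(mcomp1m f) Z0 mcomp0l. Qed.

Lemma mor_from_zero X Z (f : mor Z X) : is_zero Z -> f = 0.
Proof. by move=> /is_zeroP Z0; rewrite -(mcompm1 f) Z0 mcomp0r. Qed.

Lemma is_iso_id X : is_iso (idm X).
Proof. by exists (idm X); rewrite mcomp1m. Qed.

Lemma is_iso_comp X Y Z (g : mor Y Z) (f : mor X Y) :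
  is_iso g -> is_iso f -> is_iso (g \c f).
Proof.
move=> [g' [g'g gg']] [f' [f'f ff']]; exists (f' \c g'); split.
  by rewrite mcompA -(mcompA f') g'g mcompm1.
by rewrite mcompA -(mcompA g) ff' mcompm1.
Qed.

Lemma is_iso_mono X Y (f : mor X Y) : is_iso f -> mono f.
Proof.
move=> [f' [f'f _]] W g h fgh.
by rewrite -(mcomp1m g) -f'f -mcompA fgh mcompA f'f mcomp1m.
Qed.

Lemma is_iso_epi X Y (f : mor X Y) : is_iso f -> epi f.
Proof.
move=> [f' [_ ff']] W g h fgh.
by rewrite -(mcompm1 g) -ff' mcompA fgh -mcompA ff' mcompm1.
Qed.

Lemma iso_sym X Y : iso X Y -> iso Y X.
Proof. by move=> [f [f' [f'f ff']]]; exists f', f. Qed.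

Lemma iso_zero X Y : iso X Y -> is_zero X -> is_zero Y.
Proof.
move=> [f [g [gf fg]]] X0; apply/is_zeroP.
by rewrite -fg (mor_to_zero g X0) mcomp0r.
Qed.

Lemma kernel_mono K X Y (k : mor K X) (f : mor X Y) : is_kernel k f -> mono k.
Proof.
move=> [fk0 kU] W g h kgh.
have [u [_ uE]] : exists! u, k \c u = k \c h.
  by apply: kU; rewrite mcompA fk0 mcomp0l.
by rewrite -(uE g kgh) -(uE h erefl).
Qed.

Lemma mono0P X Y (f : mor X Y) :
  mono f <-> (forall W (g : mor W X), f \c g = 0 -> g = 0).
Proof.
split=> [fm W g fg0|f0 W g h fgh].
  by apply: fm; rewrite fg0 mcomp0r.
by apply/subr0_eq/f0; rewrite mcompBr fgh subrr.
Qed.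

Lemma epi0P X Y (f : mor X Y) :
  epi f <-> (forall W (g : mor Y W), g \c f = 0 -> g = 0).
Proof.
split=> [fm W g fg0|f0 W g h fgh].
  by apply: fm; rewrite fg0 mcomp0l.
by apply/subr0_eq/f0; rewrite mcompBl fgh subrr.
Qed.

Lemma mono_zero_kernel K X Y (k : mor K X) (f : mor X Y) :
  is_kernel k f -> is_zero K -> mono f.
Proof.
move=> [_ kU] K0; apply/mono0P => W g /kU [u [<- _]].
by rewrite (mor_from_zero k K0) mcomp0l.
Qed.

Lemma kernel_of_mono K X Y (k : mor K X) (f : mor X Y) :
  is_kernel k f -> mono f -> is_zero K.
Proof.
move=> kf fm; apply/is_zeroP/(kernel_mono kf).
by rewrite mcompm1 mcomp0r; apply: ((mono0P f).1 fm); apply: kf.1.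
Qed.

Lemma mono_zero_source X Y (f : mor X Y) : mono f -> is_zero Y -> is_zero X.
Proof.
move=> /mono0P fm Y0; apply/is_zeroP/fm; exact: mor_to_zero.
Qed.

(** The mono [f] is the kernel of some [g]; as [f] is epi, [g = 0], so the identity of [Y] factors
    through [f]. *)
Lemma abelian_mono_epi_iso X Y (f : mor X Y) :
  abelian C -> mono f -> epi f -> is_iso f.
Proof.
move=> abC fm fe; have [Z [g [gf0 fU]]] := ab_mono abC fm.
have g0 : g = 0 by apply/(epi0P f).1.
have [|h [fh _]] := fU Y (idm Y); first by rewrite g0 mcomp0l.
by exists h; split=> //; apply: fm; rewrite mcompA fh mcomp1m mcompm1.
Qed.

End Preadditive.

(** * Duality through the opposite category *)

Section Opposite.

(** Reversed morphisms make [is_kernel] in [opcat C] convertible to [is_cokernel] in [C], and [mono]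
    to [epi], so most dual statements below are mere instances. *)
Definition opcat (C : category) : category :=
  @Category C (fun X Y => mor Y X) (@idm C) (fun X Y Z g f => f \c g)
    (fun X Y f => mcompm1 f) (fun X Y f => mcomp1m f)
    (fun W X Y Z h g f => esym (mcompA f g h))
    (fun X Y Z g h f => mcompDr f g h) (fun X Y Z g f h => mcompDl f h g).

Definition opfun (C D : category) (F : functor C D) :
    functor (opcat C) (opcat D) :=
  @Functor (opcat C) (opcat D) F (fun X Y => @fmap C D F Y X)
    (@fmap1 C D F) (fun X Y Z g f => @fmapM C D F Z Y X f g).

(** The dual adjunction is given by the inverse bijections. These are only known to exist for each
    pair of objects, so choice assembles them into a family; its naturality is tested after applying
    [phi]. *)
Lemma left_adjoint_op (C D : category) (L : functor C D) (R : functor D C) :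
  left_adjoint L R -> left_adjoint (opfun R) (opfun L).
Proof.
move=> [phi [phib phiN]].
have inv X Y : exists psi, cancel (phi X Y) psi /\ cancel psi (phi X Y).
  by have [psi phiK psiK] := phib X Y; exists psi.
pose psi X Y := sval (cid (inv X Y)).
have phiK X Y : cancel (phi X Y) (psi X Y) by rewrite /psi; case: cid => ? [].
have psiK X Y : cancel (psi X Y) (phi X Y) by rewrite /psi; case: cid => ? [].
exists (fun Y X (h : mor X (R Y)) => psi X Y h); split.
  by move=> Y X; exists (phi X Y).
move=> Y Y' X X' f g h /=.
apply: (can_inj (phiK _ _)); rewrite psiK /=.
by have := phiN _ _ _ _ g f (psi X Y h); rewrite psiK -!mcompA => ->.
Qed.

Lemma is_zero_op (C : category) (X : C) :
  @is_zero (opcat C) X <-> is_zero X.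
Proof. by rewrite !is_zeroP. Qed.

Lemma cokernel_epi (C : category) (X Y Q : C) (q : mor Y Q) (f : mor X Y) :
  is_cokernel q f -> epi q.
Proof. exact: (@kernel_mono (opcat C) Q Y X q f). Qed.

Lemma epi_zero_cokernel (C : category) (X Y Q : C) (q : mor Y Q) (f : mor X Y) :
  is_cokernel q f -> is_zero Q -> epi f.
Proof.
by move=> qf /is_zero_op; apply: (@mono_zero_kernel (opcat C) Q Y X q f).
Qed.

Lemma cokernel_of_epi (C : category) (X Y Q : C) (q : mor Y Q) (f : mor X Y) :
  is_cokernel q f -> epi f -> is_zero Q.
Proof.
by move=> qf fe; apply/is_zero_op/(@kernel_of_mono (opcat C) Q Y X q f).
Qed.

Lemma epi_zero_target (C : category) (X Y : C) (f : mor X Y) :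
  epi f -> is_zero X -> is_zero Y.
Proof.
move=> fe X0; apply/is_zero_op/(@mono_zero_source (opcat C) Y X f fe).
exact/is_zero_op.
Qed.

Lemma is_iso_op (C : category) (X Y : C) (f : mor X Y) :
  is_iso (f : mor (Y : opcat C) X) -> is_iso f.
Proof. by move=> [g [gf fg]]; exists g. Qed.

End Opposite.

(** * Adjunctions: units, universal arrows, exactness, full faithfulness *)

Section Adjoint.
Variables (C D : category) (L : functor C D) (R : functor D C).

Lemma fmap_iso X Y (f : mor X Y) : is_iso f -> is_iso (fmap L f).
Proof.
by move=> [g [gf fg]]; exists (fmap L g); rewrite -!fmapM gf fg !fmap1.
Qed.

Lemma fmap0 X Y : additive_functor L -> fmap L (0 : mor X Y) = 0.
Proof. by move=> La; apply: (addrI (fmap L 0)); rewrite -La !addr0. Qed.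

(** With [phi (idm _)] as unit, naturality in the target turns [phi h] into [fmap R h] composed with
    the unit. *)
Lemma left_adjoint_unit : left_adjoint L R ->
  exists eta : forall X, mor X (R (L X)),
    (forall X X' (f : mor X X'), fmap R (fmap L f) \c eta X = eta X' \c f) /\
    (forall X Y, bijective (fun h : mor (L X) Y => fmap R h \c eta X)).
Proof.
move=> [phi [phib phiN]]; exists (fun X => phi X (L X) (idm (L X))).
have phiE X Y (h : mor (L X) Y) :
    fmap R h \c phi X (L X) (idm (L X)) = phi X Y h.
  have := phiN X X _ _ (idm X) h (idm (L X)).
  by rewrite fmap1 !mcompm1.
split=> [X X' f|X Y]; last by apply: eq_bij (phib X Y) _ _ => h; rewrite phiE.
rewrite phiE; have := phiN X' X _ _ f (idm (L X')) (idm (L X')).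
by rewrite fmap1 !mcomp1m.
Qed.

(** Choice picks a universal arrow out of each object; uniqueness of factorizations then forces
    functoriality and naturality. *)
Lemma universal_left_adjoint :
  (forall X : C, exists (Y : D) (u : mor X (R Y)), forall Z (f : mor X (R Z)),
     exists! g : mor Y Z, fmap R g \c u = f) ->
  exists F : functor C D, left_adjoint F R.
Proof.
move=> univ.
have arrow X : {Yu : {Y & mor X (R Y)} | forall Z (f : mor X (R Z)),
    exists! g : mor (projT1 Yu) Z, fmap R g \c projT2 Yu = f}.
  by have /cid [Y /cid [v vU]] := univ X; exists (existT _ Y v).
pose FO X := projT1 (sval (arrow X)); pose u X := projT2 (sval (arrow X)).
have uU X Z (f : mor X (R Z)) : exists! g : mor (FO X) Z, fmap R g \c u X = f.
  exact: svalP (arrow X) Z f.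
pose ext X Z f := sval (cid (uU X Z f)).
have extK X Z f : fmap R (ext X Z f) \c u X = f.
  by rewrite /ext; case: cid => /= g [].
have uI X Z (g h : mor (FO X) Z) : fmap R g \c u X = fmap R h \c u X -> g = h.
  by move=> E; have [k [_ kU]] := uU X Z (fmap R h \c u X);
     rewrite -(kU g E) -(kU h erefl).
pose FM X Y (f : mor X Y) : mor (FO X) (FO Y) := ext X _ (u Y \c f).
have FMK X Y (f : mor X Y) : fmap R (FM X Y f) \c u X = u Y \c f by apply: extK.
have FM1 X : FM _ _ (idm X) = idm (FO X).
  by apply: uI; rewrite FMK fmap1 mcomp1m mcompm1.
have FMM X Y Z (g : mor Y Z) (f : mor X Y) :
    FM _ _ (g \c f) = FM _ _ g \c FM _ _ f.
  by apply: uI; rewrite FMK fmapM -[RHS]mcompA FMK [RHS]mcompA FMK mcompA.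
exists (Functor FM1 FMM), (fun X Y h => fmap R h \c u X); split.
  move=> X Y; exists (ext X Y) => [h|f]; last exact: extK.
  by apply: uI; rewrite extK.
move=> X X' Y Y' f g h /=.
by rewrite !fmapM -mcompA FMK !mcompA.
Qed.

Hypothesis adj : left_adjoint L R.

Lemma left_adjoint_additive : additive_functor R -> additive_functor L.
Proof.
have [eta [etaN etab]] := left_adjoint_unit adj.
move=> Ra X Y f g; apply: (bij_inj (etab _ _)) => /=.
by rewrite Ra mcompDl !etaN mcompDr.
Qed.

(** A map out of [L Y] that kills [fmap L f] is transposed to a map out of [Y] that kills [f]; the
    latter factors through [q], and the factorization is transposed back. *)
Lemma left_adjoint_cokernel X Y Q (q : mor Y Q) (f : mor X Y) :
  additive_functor L -> additive_functor R ->
  is_cokernel q f -> is_cokernel (fmap L q) (fmap L f).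
Proof.
have [eta [etaN etab]] := left_adjoint_unit adj.
move=> La Ra [qf0 qU]; split; first by rewrite -fmapM qf0 fmap0.
move=> W g gLf0.
have [|h [hq hU]] := qU _ (fmap R g \c eta Y).
  by rewrite -mcompA -etaN mcompA -fmapM gLf0;
     have -> : fmap R (0 : mor (L X) W) = 0;
     [apply: (addrI (fmap R 0)); rewrite -Ra !addr0|rewrite mcomp0l].
have [psi psiK Kpsi] := etab Q W; exists (psi h); split.
  apply: (bij_inj (etab _ _)) => /=.
  by rewrite fmapM -mcompA etaN mcompA Kpsi.
move=> k kq; apply: (can_inj psiK); rewrite Kpsi; apply: hU.
by rewrite -kq fmapM -!mcompA etaN.
Qed.

(** By naturality of the unit, composing [f] with the unit of its target is [fmap L] followed by the
    adjunction bijection. So [L] is fully faithful exactly when these compositions are bijective,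
    which by the Yoneda argument means that the unit is invertible. *)
Lemma unit_fully_faithful (eta : forall X, mor X (R (L X))) :
    (forall X X' (f : mor X X'), fmap R (fmap L f) \c eta X = eta X' \c f) ->
    (forall X Y, bijective (fun h : mor (L X) Y => fmap R h \c eta X)) ->
  fully_faithful L <-> forall X, is_iso (eta X).
Proof.
move=> etaN etab; split=> [Lff X|etaI X Y].
  have b W : bijective (fun f : mor W X => eta X \c f).
    apply: eq_bij (bij_comp (etab W (L X)) (Lff W X)) _ _ => f /=.
    exact: etaN.
  have [r _ rK] := b (R (L X)).
  exists (r (idm _)); split; last exact: rK.
  apply: (bij_inj (b X)) => /=.
  by rewrite mcompA rK mcomp1m mcompm1.
have b : bijective (fun f : mor X Y => eta Y \c f).
  have [r [rK Kr]] := etaI Y.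
  by exists (fun f => r \c f) => f; rewrite mcompA ?rK ?Kr mcomp1m.
have [psi psiK Kpsi] := etab X (L Y).
apply: eq_bij (bij_comp (Bijective Kpsi psiK) b) _ _ => f /=.
by apply: (can_inj psiK); rewrite Kpsi etaN.
Qed.

End Adjoint.

Section RightAdjoint.
Variables (C D : category) (L : functor C D) (R : functor D C).
Hypothesis adj : left_adjoint L R.

Lemma right_adjoint_additive : additive_functor L -> additive_functor R.
Proof.
move=> La X Y f g.
exact: (left_adjoint_additive (left_adjoint_op adj) (fun X Y f g => La Y X f g)).
Qed.

Lemma right_adjoint_kernel K X Y (k : mor K X) (f : mor X Y) :
  additive_functor L -> additive_functor R ->
  is_kernel k f -> is_kernel (fmap R k) (fmap R f).
Proof.
move=> La Ra; exact: (left_adjoint_cokernel (left_adjoint_op adj)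
  (fun X Y f g => Ra Y X f g) (fun X Y f g => La Y X f g)).
Qed.

Lemma left_adjoint_counit :
  exists eps : forall Y, mor (L (R Y)) Y,
    (forall Y Y' (g : mor Y Y'), eps Y' \c fmap L (fmap R g) = g \c eps Y) /\
    (forall X Y, bijective (fun h : mor X (R Y) => eps Y \c fmap L h)).
Proof.
have [eps [epsN epsb]] := left_adjoint_unit (left_adjoint_op adj).
by exists eps; split=> [Y Y' g|X Y]; [exact: epsN|exact: epsb].
Qed.

Lemma counit_fully_faithful (eps : forall Y, mor (L (R Y)) Y) :
    (forall Y Y' (g : mor Y Y'), eps Y' \c fmap L (fmap R g) = g \c eps Y) ->
    (forall X Y, bijective (fun h : mor X (R Y) => eps Y \c fmap L h)) ->
  fully_faithful R -> forall Y, is_iso (eps Y).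
Proof.
move=> epsN epsb Rff Y; apply: is_iso_op.
apply: (unit_fully_faithful (L := opfun R) (R := opfun L) (eta := eps) _ _).1.
- by move=> X X' f; apply: epsN.
- by move=> X Z; apply: epsb.
- by move=> X Z; apply: Rff.
Qed.

End RightAdjoint.

Lemma universal_right_adjoint (C D : category) (L : functor C D) :
  (forall Y : D, exists (X : C) (u : mor (L X) Y), forall Z (f : mor (L Z) Y),
     exists! g : mor Z X, u \c fmap L g = f) ->
  exists G : functor D C, left_adjoint L G.
Proof.
move=> univ.
have [G adj] := universal_left_adjoint (R := opfun L) univ.
exists (@Functor D C G (fun X Y f => fmap G (f : mor (Y : opcat D) X))
  (fmap1 G) (fun X Y Z g f => fmapM G (f : mor (Y : opcat D) X) g)).
exact: left_adjoint_op adj.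
Qed.

(* In an adjoint triple [L -| J -| R], the functor [L] is fully faithful as soon
   as [R] is: precomposition with the unit [X -> J (L X)] is, up to the
   invertible counit of [J -| R], the composite of the two adjunction
   bijections. *)
Lemma adjoint_triple_fully_faithful (C D : category) (J : functor D C)
    (L R : functor C D) :
  left_adjoint L J -> left_adjoint J R -> fully_faithful R -> fully_faithful L.
Proof.
move=> LJ JR Rff.
have [eta [etaN etab]] := left_adjoint_unit LJ.
have [eps [epsN epsb]] := left_adjoint_counit JR.
have epsI := counit_fully_faithful epsN epsb Rff.
apply/(unit_fully_faithful etaN etab) => X.
have cancel_eta Z (g h : mor (J (L X)) Z) : g \c eta X = h \c eta X -> g = h.
  have [s sK Ks] := epsb (L X) Z; rewrite -(Ks g) -(Ks h) -!mcompA.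
  by move=> /(is_iso_mono (epsI Z))/(bij_inj (etab _ _)) ->.
have [e [_ eK]] := epsI X.
have [t _ tK] := etab X (R X).
have rK : eps X \c fmap J (t e) \c eta X = idm X by rewrite -mcompA tK.
exists (eps X \c fmap J (t e)); split=> //.
by apply: cancel_eta; rewrite -mcompA rK mcomp1m mcompm1.
Qed.

(** * Natural isomorphisms and equivalences *)

Section NatIso.

Lemma nat_iso_refl (C D : category) (F : functor C D) : nat_iso F F.
Proof.
exists (fun X => idm (F X)); split=> [X|X Y f]; first exact: is_iso_id.
by rewrite mcomp1m mcompm1.
Qed.

Lemma nat_iso_sym (C D : category) (F G : functor C D) :
  nat_iso F G -> nat_iso G F.
Proof.
move=> [e [/(_ _)/cid eI eN]]; exists (fun X => sval (eI X)); split=> [X|X Y f].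
  by case: (eI X) => g [gK Kg]; exists (e X).
move: (sval (eI X)) (svalP (eI X)) (sval (eI Y)) (svalP (eI Y)).
move=> g [gK Kg] h [hK Kh].
by rewrite -[LHS]mcomp1m -hK -mcompA (mcompA (e Y)) -eN -mcompA Kg mcompm1.
Qed.

Lemma nat_iso_trans (C D : category) (F G H : functor C D) :
  nat_iso F G -> nat_iso G H -> nat_iso F H.
Proof.
move=> [a [aI aN]] [b [bI bN]]; exists (fun X => b X \c a X); split=> [X|X Y f].
  exact: is_iso_comp.
by rewrite mcompA bN -mcompA aN mcompA.
Qed.

Lemma nat_iso_precomp (C D E : category) (F G : functor D E) (H : functor C D) :
  nat_iso F G -> nat_iso (F \F H) (G \F H).
Proof.
move=> [a [aI aN]]; exists (fun X => a (H X)).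
by split=> [X|X Y f]; [exact: aI|exact: aN].
Qed.

Lemma nat_iso_postcomp (C D E : category) (F G : functor C D) (H : functor D E) :
  nat_iso F G -> nat_iso (H \F F) (H \F G).
Proof.
move=> [a [aI aN]]; exists (fun X => fmap H (a X)).
by split=> [X|X Y f /=]; [exact: fmap_iso (aI X)|rewrite -!fmapM aN].
Qed.

Lemma nat_iso_zero (C D : category) (F G : functor C D) X :
  nat_iso F G -> is_zero (F X) -> is_zero (G X).
Proof. by move=> [a [aI aN]]; apply: iso_zero; exists (a X). Qed.

Lemma nat_iso_id_faithful (C : category) (F : functor C C) X Y (f g : mor X Y) :
  nat_iso F (id_functor C) -> fmap F f = fmap F g -> f = g.
Proof.
move=> [a [aI aN]] E; apply: (is_iso_epi (aI X)).
by have := aN _ _ f; have /= := aN _ _ g; rewrite E => -> ->.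
Qed.

(* [F] need not be additive, so its action on zero objects is controlled through
   faithfulness rather than through [fmap F 0 = 0]. *)
Lemma equivalence_zero (C D : category) (F : functor C D) X :
  equivalence F -> is_zero (F X) <-> is_zero X.
Proof.
move=> [G [GF FG]]; split=> [FX0|X0]; apply/is_zeroP.
  apply: (nat_iso_id_faithful GF) => /=; congr (fmap G _).
  by rewrite (mor_to_zero (fmap F (idm X)) FX0) (mor_to_zero (fmap F 0) FX0).
apply: (nat_iso_id_faithful FG) => /=; congr (fmap F _).
have GFX0 : is_zero (G (F X)) by apply: nat_iso_zero (nat_iso_sym GF) X0.
by rewrite (mor_to_zero (fmap G (idm _)) GFX0) (mor_to_zero (fmap G 0) GFX0).
Qed.

End NatIso.

(** * Modules *)

Section Homs.
Variable A : pzRingType.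
Implicit Types M N P : lmodType A^c.

(** The right action carried by a left module over the converse ring; in this notation products
    appear in the order of [A]. *)
Definition act M (m : M) (a : A) : M := (a : A^c) *: m.
Local Notation "m *> a" := (act m a) (at level 38, left associativity).

Lemma actA M (m : M) a b : m *> a *> b = m *> (a * b).
Proof. by rewrite /act scalerA. Qed.
Lemma actDl M (m n : M) a : (m + n) *> a = m *> a + n *> a.
Proof. by rewrite /act scalerDr. Qed.
Lemma actDr M (m : M) a b : m *> (a + b) = m *> a + m *> b.
Proof. by rewrite /act scalerDl. Qed.
Lemma act0l M a : (0 : M) *> a = 0.
Proof. by rewrite /act scaler0. Qed.
Lemma act0r M (m : M) : m *> 0 = 0.
Proof. by rewrite /act scale0r. Qed.
Lemma act1 M (m : M) : m *> 1 = m.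
Proof. by rewrite /act scale1r. Qed.
Lemma actNl M (m : M) a : (- m) *> a = - (m *> a).
Proof. by rewrite /act scalerN. Qed.
Lemma actBl M (m n : M) a : (m - n) *> a = m *> a - n *> a.
Proof. by rewrite actDl actNl. Qed.
Lemma act_sumr M (m : M) n (a : 'I_n -> A) :
  m *> (\sum_(i < n) a i) = \sum_(i < n) m *> a i.
Proof. by rewrite /act scaler_suml. Qed.

Definition ap M N (f : @mor (Mod A) M N) : M -> N := (f : {linear M -> N}).

Lemma apD M N (f : @mor (Mod A) M N) x y : ap f (x + y) = ap f x + ap f y.
Proof. exact: linearD. Qed.
Lemma apB M N (f : @mor (Mod A) M N) x y : ap f (x - y) = ap f x - ap f y.
Proof. exact: linearB. Qed.
Lemma ap0 M N (f : @mor (Mod A) M N) : ap f 0 = 0.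
Proof. exact: linear0. Qed.
Lemma apM M N (f : @mor (Mod A) M N) x a : ap f (x *> a) = ap f x *> a.
Proof. exact: linearZ. Qed.
Lemma apc M N P (g : @mor (Mod A) N P) (f : @mor (Mod A) M N) x :
  ap (g \c f) x = ap g (ap f x).
Proof. by []. Qed.
Lemma ap_id M (x : M) : ap (@idm (Mod A) M) x = x.
Proof. by []. Qed.
Lemma ap_add M N (f g : @mor (Mod A) M N) (x : M) : ap (f + g) x = ap f x + ap g x.
Proof. by []. Qed.

Lemma hom_ext M N (f g : @mor (Mod A) M N) : (forall x, ap f x = ap g x) -> f = g.
Proof. exact: mod_homP. Qed.

(** Morphisms are obtained from here as existence statements, so that later arguments see only their
    values and never the packed structure. *)
Lemma hom_exists M N (f : M -> N) :
    (forall x y, f (x + y) = f x + f y) ->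
    (forall x a, f (x *> a) = f x *> a) ->
  exists g : @mor (Mod A) M N, forall x, ap g x = f x.
Proof.
move=> fD fM.
have flin : linear f by move=> a x y; rewrite fD; congr (_ + _); apply: fM.
pose flm := GRing.isLinear.Build A^c M N *:%R f flin.
pose g : {linear M -> N} := HB.pack f flm.
by exists (g : mod_hom M N).
Qed.

End Homs.
Notation "m *> a" := (act m a) (at level 38, left associativity).

(** * Modules presented up to an equivalence relation *)

Section SetoidModule.
Variable R : pzRingType.

(** Submodules, quotients, Hom modules and tensor products all start from a raw type whose
    operations satisfy the module laws up to a relation; the passage to the quotient is made once,
    here. *)
Record setoid_module_axioms (E : Type) (eqE : E -> E -> Prop)
    (add : E -> E -> E) (zero : E) (opp : E -> E) (scale : R -> E -> E) : Prop :=
  SetoidModuleAxioms {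
  sma_refl : forall x, eqE x x;
  sma_sym : forall x y, eqE x y -> eqE y x;
  sma_trans : forall x y z, eqE x y -> eqE y z -> eqE x z;
  sma_add_eq : forall x x' y y', eqE x x' -> eqE y y' ->
    eqE (add x y) (add x' y');
  sma_opp_eq : forall x x', eqE x x' -> eqE (opp x) (opp x');
  sma_scale_eq : forall a x x', eqE x x' -> eqE (scale a x) (scale a x');
  sma_addA : forall x y z, eqE (add x (add y z)) (add (add x y) z);
  sma_addC : forall x y, eqE (add x y) (add y x);
  sma_add0 : forall x, eqE (add zero x) x;
  sma_addN : forall x, eqE (add (opp x) x) zero;
  sma_scaleA : forall a b x, eqE (scale a (scale b x)) (scale (a * b) x);
  sma_scale1 : forall x, eqE (scale 1 x) x;
  sma_scaleDr : forall a x y,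
    eqE (scale a (add x y)) (add (scale a x) (scale a y));
  sma_scaleDl : forall x a b,
    eqE (scale (a + b) x) (add (scale a x) (scale b x)) }.

Record setoid_module := SetoidModule {
  sm_car :> Type;
  sm_eq : sm_car -> sm_car -> Prop;
  sm_add : sm_car -> sm_car -> sm_car;
  sm_zero : sm_car;
  sm_opp : sm_car -> sm_car;
  sm_scale : R -> sm_car -> sm_car;
  sm_axioms : setoid_module_axioms sm_eq sm_add sm_zero sm_opp sm_scale }.

Variable S : setoid_module.
Let smS := sm_axioms S.


(** Elements are the equivalence classes themselves, as predicates, so extensionality makes equality
    of classes coincide with the relation. *)
Definition sm_quot : Type := {P : S -> Prop | exists x, P = sm_eq x}.

HB.instance Definition _ := gen_eqMixin sm_quot.
HB.instance Definition _ := gen_choiceMixin sm_quot.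

Definition sm_pi (x : S) : sm_quot := exist _ (sm_eq x) (ex_intro _ x erefl).
Definition sm_repr (q : sm_quot) : S := sval (cid (svalP q)).

Lemma sm_reprK q : sm_pi (sm_repr q) = q.
Proof.
rewrite /sm_repr; case: cid => x /= E; case: q E => P Px /= E.
by apply: eq_exist.
Qed.

Lemma sm_pi_eq x y : sm_pi x = sm_pi y <-> sm_eq x y.
Proof.
split=> [[E]|xy]; first by rewrite E; apply: (sma_refl smS).
apply: eq_exist; apply/funext => z; apply/propext; split.
  by apply: (sma_trans smS); apply: (sma_sym smS).
exact: (sma_trans smS).
Qed.

Lemma sm_repr_pi x : sm_eq (sm_repr (sm_pi x)) x.
Proof. by apply/sm_pi_eq; rewrite sm_reprK. Qed.

Definition smq_add p q := sm_pi (sm_add (sm_repr p) (sm_repr q)).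
Definition smq_opp p := sm_pi (sm_opp (sm_repr p)).
Definition smq_scale a p := sm_pi (sm_scale a (sm_repr p)).

Lemma sm_piD x y : sm_pi (sm_add x y) = smq_add (sm_pi x) (sm_pi y).
Proof. by apply/sm_pi_eq/(sma_add_eq smS); apply/(sma_sym smS)/sm_repr_pi. Qed.
Lemma sm_piN x : sm_pi (sm_opp x) = smq_opp (sm_pi x).
Proof. by apply/sm_pi_eq/(sma_opp_eq smS); apply/(sma_sym smS)/sm_repr_pi. Qed.
Lemma sm_piZ a x : sm_pi (sm_scale a x) = smq_scale a (sm_pi x).
Proof. by apply/sm_pi_eq/(sma_scale_eq smS); apply/(sma_sym smS)/sm_repr_pi. Qed.

Fact smq_addA : associative smq_add.
Proof.
move=> p q r; rewrite -(sm_reprK p) -(sm_reprK q) -(sm_reprK r) -!sm_piD.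
exact/sm_pi_eq/(sma_addA smS).
Qed.
Fact smq_addC : commutative smq_add.
Proof.
move=> p q; rewrite -(sm_reprK p) -(sm_reprK q) -!sm_piD.
exact/sm_pi_eq/(sma_addC smS).
Qed.
Fact smq_add0 : left_id (sm_pi (sm_zero S)) smq_add.
Proof. by move=> p; rewrite -(sm_reprK p) -!sm_piD; apply/sm_pi_eq/(sma_add0 smS). Qed.
Fact smq_addN : left_inverse (sm_pi (sm_zero S)) smq_opp smq_add.
Proof.
by move=> p; rewrite -(sm_reprK p) -sm_piN -!sm_piD; apply/sm_pi_eq/(sma_addN smS).
Qed.

HB.instance Definition _ := GRing.isZmodule.Build sm_quot
  smq_addA smq_addC smq_add0 smq_addN.

Fact smq_scaleA a b p : smq_scale a (smq_scale b p) = smq_scale (a * b) p.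
Proof. by rewrite -(sm_reprK p) -!sm_piZ; apply/sm_pi_eq/(sma_scaleA smS). Qed.
Fact smq_scale1 : left_id 1 smq_scale.
Proof. by move=> p; rewrite -(sm_reprK p) -!sm_piZ; apply/sm_pi_eq/(sma_scale1 smS). Qed.
Fact smq_scaleDr : right_distributive smq_scale smq_add.
Proof.
move=> a p q; rewrite -(sm_reprK p) -(sm_reprK q) -sm_piD -!sm_piZ -sm_piD.
exact/sm_pi_eq/(sma_scaleDr smS).
Qed.
Fact smq_scaleDl p a b :
  smq_scale (a + b) p = smq_add (smq_scale a p) (smq_scale b p).
Proof.
rewrite -(sm_reprK p) -!sm_piZ -sm_piD.
exact/sm_pi_eq/(sma_scaleDl smS).
Qed.

HB.instance Definition _ := GRing.Zmodule_isLmodule.Build R sm_quot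
  smq_scaleA smq_scale1 smq_scaleDr smq_scaleDl.

End SetoidModule.

Lemma setoid_module_exists (R : pzRingType) (E : Type) (eqE : E -> E -> Prop)
    (add : E -> E -> E) (zero : E) (opp : E -> E) (scale : R -> E -> E) :
    setoid_module_axioms eqE add zero opp scale ->
  exists (Q : lmodType R) (pi : E -> Q),
  [/\ forall q, exists x, pi x = q, forall x y, pi x = pi y <-> eqE x y,
      forall x y, pi (add x y) = pi x + pi y
    & forall a x, pi (scale a x) = a *: pi x].
Proof.
move=> ax; pose S := SetoidModule ax; exists (sm_quot S), (@sm_pi R S); split.
- by move=> q; exists (sm_repr q); apply: sm_reprK.
- by move=> x y; apply: (@sm_pi_eq R S).
- by move=> x y; apply: (@sm_piD R S).
- by move=> a x; apply: (@sm_piZ R S).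
Qed.

(** * Submodules, quotients, Hom and tensor modules *)

Section Constructions.
Variable A : pzRingType.
Implicit Types M N P Q K W X : lmodType A^c.

Record submodule M (S : M -> Prop) : Prop := Submodule {
  submod0 : S 0;
  submodD : forall x y, S x -> S y -> S (x + y);
  submodM : forall x a, S x -> S (x *> a) }.

Definition inj_hom M N (f : @mor (Mod A) M N) := forall x, ap f x = 0 -> x = 0.
Definition surj_hom M N (f : @mor (Mod A) M N) := forall y, exists x, ap f x = y.

Lemma inj_homP M N (f : @mor (Mod A) M N) x y :
  inj_hom f -> ap f x = ap f y -> x = y.
Proof. by move=> fi fxy; apply/subr0_eq/fi; rewrite apB fxy subrr. Qed.

Lemma surj_hom_epi M N (f : @mor (Mod A) M N) : surj_hom f -> epi f.
Proof.
by move=> fs W g h fgh; apply: hom_ext => y; have [x <-] := fs y;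
  rewrite -!apc fgh.
Qed.

Lemma inj_hom_mono M N (f : @mor (Mod A) M N) : inj_hom f -> mono f.
Proof.
move=> fi W g h fgh; apply: hom_ext => x; apply: (inj_homP fi).
by rewrite -!apc fgh.
Qed.

Lemma lift_inj K M N (k : @mor (Mod A) K M) (f : @mor (Mod A) N M) :
  inj_hom k -> (forall n, exists x, ap k x = ap f n) -> exists g, k \c g = f.
Proof.
move=> ki kf; pose u n := sval (cid (kf n)).
have uE n : ap k (u n) = ap f n by rewrite /u; case: cid.
have [|x a|g gE] := @hom_exists A N K u.
- by move=> x y; apply: (inj_homP ki); rewrite apD !uE apD.
- by apply: (inj_homP ki); rewrite apM !uE apM.
by exists g; apply: hom_ext => n; rewrite apc gE uE.
Qed.

Lemma factor_surj M Q N (q : @mor (Mod A) M Q) (f : @mor (Mod A) M N) :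
  surj_hom q -> (forall x, ap q x = 0 -> ap f x = 0) -> exists g, g \c q = f.
Proof.
move=> qs qf; pose u y := sval (cid (qs y)).
have uE y : ap q (u y) = y by rewrite /u; case: cid.
have fE x y : ap q x = ap q y -> ap f x = ap f y.
  by move=> E; apply/subr0_eq; rewrite -apB qf // apB E subrr.
have [|x a|g gE] := @hom_exists A Q N (fun y => ap f (u y)).
- by move=> x y; rewrite -apD; apply: fE; rewrite apD !uE.
- by rewrite -apM; apply: fE; rewrite apM !uE.
by exists g; apply: hom_ext => x; rewrite apc gE; apply: fE; rewrite uE.
Qed.

Lemma mod_is_kernel K M N (k : @mor (Mod A) K M) (f : @mor (Mod A) M N) :
  inj_hom k -> (forall x, ap f x = 0 <-> exists y, ap k y = x) -> is_kernel k f.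
Proof.
move=> ki kf; split.
  by apply: hom_ext => x; rewrite apc; apply/kf; exists x.
move=> W g fg0; have [|h hE] := @lift_inj _ _ _ k g ki.
  by move=> w; apply/kf; rewrite -apc fg0.
exists h; split=> // h' h'E; apply: (inj_hom_mono ki).
by rewrite hE h'E.
Qed.

Lemma mod_is_cokernel M N Q (q : @mor (Mod A) N Q) (f : @mor (Mod A) M N) :
  surj_hom q -> (forall y, ap q y = 0 <-> exists x, ap f x = y) ->
  is_cokernel q f.
Proof.
move=> qs qf; split.
  by apply: hom_ext => x; rewrite apc; apply/qf; exists x.
move=> W g gf0; have [|h hE] := @factor_surj _ _ _ q g qs.
  by move=> y /qf [x <-]; rewrite -apc gf0.
exists h; split=> // h' h'E; apply: (surj_hom_epi qs).
by rewrite hE h'E.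
Qed.

Lemma inj_surj_iso M N (f : @mor (Mod A) M N) : inj_hom f -> surj_hom f -> is_iso f.
Proof.
move=> fi fs; have [|g gf] := @factor_surj _ _ _ f (@idm (Mod A) M) fs.
  by move=> x /fi ->; rewrite ap0.
exists g; split=> //; apply: (surj_hom_epi fs).
by rewrite -mcompA gf mcompm1 mcomp1m.
Qed.

Lemma iso_inj M N (f : @mor (Mod A) M N) : is_iso f -> inj_hom f.
Proof.
by move=> [g [gf _]] x fx0; rewrite -(ap_id x) -gf apc fx0 ap0.
Qed.

Lemma iso_surj M N (f : @mor (Mod A) M N) : is_iso f -> surj_hom f.
Proof. by move=> [g [_ fg]] y; exists (ap g y); rewrite -apc fg. Qed.

Lemma mod_is_zero M : @is_zero (Mod A) M <-> forall m : M, m = 0.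
Proof.
rewrite is_zeroP; split=> [M0 m|M0]; first by rewrite -(ap_id m) M0.
by apply: hom_ext => m; rewrite [LHS]M0.
Qed.

Lemma submodule_ker M N (f : @mor (Mod A) M N) : submodule (fun x => ap f x = 0).
Proof.
split=> [|x y fx fy|x a fx]; first exact: ap0.
  by rewrite apD fx fy addr0.
by rewrite apM fx act0l.
Qed.

Lemma submodule_im M N (f : @mor (Mod A) M N) :
  submodule (fun y => exists x, ap f x = y).
Proof.
split=> [|_ _ [x <-] [y <-]|_ a [x <-]]; first by exists 0; exact: ap0.
  by exists (x + y); rewrite apD.
by exists (x *> a); rewrite apM.
Qed.

Lemma submodN M (S : M -> Prop) x : submodule S -> S x -> S (- x).
Proof. by move=> Ss /(submodM Ss (-1)); rewrite /act scaleN1r. Qed.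

Lemma submod_sum M (S : M -> Prop) n (x : 'I_n -> M) :
  submodule S -> (forall i, S (x i)) -> S (\sum_(i < n) x i).
Proof.
move=> Ss Sx; elim/big_rec: _ => [|i y _ Sy]; first exact: submod0.
exact: submodD.
Qed.

Lemma sub_exists M (S : M -> Prop) : submodule S ->
  exists (K : lmodType A^c) (k : @mor (Mod A) K M),
    inj_hom k /\ forall m, S m <-> exists x, ap k x = m.
Proof.
move=> Ss.
pose car := {x : M | S x}.
pose add (x y : car) : car := exist _ _ (submodD Ss (svalP x) (svalP y)).
pose opp (x : car) : car := exist _ _ (submodN Ss (svalP x)).
pose scale (a : A^c) (x : car) : car := exist _ _ (submodM Ss a (svalP x)).
(* Comparing first components alone makes the membership proofs irrelevant. *)
have [] := @setoid_module_exists A^c car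
  (fun x y => sval x = sval y) add (exist _ _ (submod0 Ss)) opp scale
  _; first split=> /=.
- by [].
- by [].
- by move=> x y z -> ->.
- by move=> x x' y y' -> ->.
- by move=> x x' ->.
- by move=> a x x' ->.
- by move=> x y z; rewrite addrA.
- by move=> x y; rewrite addrC.
- by move=> x; rewrite add0r.
- by move=> x; rewrite addNr.
- by move=> a b x; rewrite /act scalerA.
- by move=> x; rewrite /act scale1r.
- by move=> a x y; rewrite /act scalerDr.
- by move=> x a b; rewrite /act scalerDl.
move=> K [pi [pis pieq piD piZ]].
pose u q := sval (cid (pis q)).
have uK q : pi (u q) = q by rewrite /u; case: cid.
have [x y|x a|k kE] := @hom_exists A K M (fun q => sval (u q)).
- have /pieq : pi (u (x + y)) = pi (add (u x) (u y)) by rewrite piD !uK.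
  by [].
- have /pieq : pi (u (x *> a)) = pi (scale a (u x)) by rewrite piZ !uK.
  by [].
exists K, k; split=> [q|m].
  rewrite kE => q0; rewrite -(uK q) -(addr0 0).
  have -> : pi (u q) = pi (exist _ _ (submod0 Ss)) by apply/pieq.
  (* [pi] is only known to be additive, so its value at zero is found by cancellation. *)
  apply: (addrI (pi (exist _ _ (submod0 Ss)))); rewrite !addr0 -piD.
  by apply/pieq; rewrite /= addr0.
split=> [Sm|[x <-]]; last by rewrite kE; apply: svalP.
exists (pi (exist _ m Sm)); rewrite kE.
by have /pieq : pi (u (pi (exist _ m Sm))) = pi (exist _ m Sm) by rewrite uK.
Qed.

Lemma quot_exists M (S : M -> Prop) : submodule S ->
  exists (Q : lmodType A^c) (q : @mor (Mod A) M Q),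
    surj_hom q /\ forall m, ap q m = 0 <-> S m.
Proof.
move=> Ss.
have S0 x y : x = y -> S (x - y) by move=> ->; rewrite subrr; apply: submod0.
have [] := @setoid_module_exists A^c M
  (fun x y => S (x - y)) +%R 0 -%R *:%R
  _; first split=> /=.
- by move=> x; apply: S0.
- by move=> x y xy; rewrite -opprB; apply: submodN.
- by move=> x y z xy yz; rewrite -(subrK y x) -addrA; apply: submodD.
- by move=> x x' y y' xx yy; rewrite opprD addrACA; apply: submodD.
- by move=> x x' xx; rewrite -opprD; apply: submodN.
- by move=> a x x' /(submodM Ss a); rewrite actBl.
- by move=> x y z; apply/S0/addrA.
- by move=> x y; apply/S0/addrC.
- by move=> x; apply/S0/add0r.
- by move=> x; apply/S0/addNr.
- by move=> a b x; apply/S0/scalerA.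
- by move=> x; apply/S0/scale1r.
- by move=> a x y; apply/S0/scalerDr.
- by move=> x a b; apply/S0/scalerDl.
move=> Q [pi [pis pieq piD piZ]].
have [|x a|q qE] := @hom_exists A M Q pi.
- exact: piD.
- exact: piZ.
exists Q, q; split=> [y|m].
  by have [x <-] := pis y; exists x; apply: qE.
by rewrite -(ap0 q) !qE pieq subr0.
Qed.

Section Ideal.
Variable I : A -> Prop.
Hypothesis I2 : two_sided_ideal I.

(** A right linear map from [I] to [W], given as a function on all of [A] and constrained on [I]
    alone; [I] itself need not be made into a module. *)
Record lin_on_ideal W (f : A -> W) : Prop := LinOnIdeal {
  lin_onD : forall x y, I x -> I y -> f (x + y) = f x + f y;
  lin_onM : forall x a, I x -> f (x * a) = f x *> a }.

(* [H] is [Hom_A(I, W)], an element [h] acting on [I] by [ev h]; the values of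
   [ev h] outside [I] are junk. *)
Lemma hom_module_exists W :
  exists (H : lmodType A^c) (ev : H -> A -> W),
  [/\ forall h, lin_on_ideal (ev h),
      forall h h' x, I x -> ev (h + h') x = ev h x + ev h' x,
      forall h a x, I x -> ev (h *> a) x = ev h (a * x),
      forall f, lin_on_ideal f -> exists h, forall x, I x -> ev h x = f x
    & forall h h', (forall x, I x -> ev h x = ev h' x) -> h = h'].
Proof.
have linD f g : @lin_on_ideal W f -> lin_on_ideal g ->
    lin_on_ideal (fun x => f x + g x).
  move=> [fD fM] [gD gM]; split=> [x y Ix Iy|x a Ix].
    by rewrite fD // gD // addrACA.
  by rewrite fM // gM // actDl.
have lin0 : @lin_on_ideal W (fun x => 0).
  by split=> [x y _ _|x a _]; rewrite ?addr0 ?act0l.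
have linN f : @lin_on_ideal W f -> lin_on_ideal (fun x => - f x).
  move=> [fD fM]; split=> [x y Ix Iy|x a Ix]; first by rewrite fD // opprD.
  by rewrite fM // actNl.
have linZ f a : @lin_on_ideal W f -> lin_on_ideal (fun x => f (a * x)).
  move=> [fD fM]; split=> [x y Ix Iy|x b Ix].
    by rewrite mulrDr fD //; apply: idealMl.
  by rewrite mulrA fM //; apply: idealMl.
pose car := {f : A -> W | lin_on_ideal f}.
pose add (f g : car) : car := exist _ _ (linD _ _ (svalP f) (svalP g)).
pose opp (f : car) : car := exist _ _ (linN _ (svalP f)).
pose scale (a : A^c) (f : car) : car := exist _ _ (linZ _ a (svalP f)).
have [] := @setoid_module_exists A^c car
  (fun f g => forall x, I x -> sval f x = sval g x) add (exist _ _ lin0) opp scale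
  _; first split=> /=.
- by [].
- by move=> f g fg x Ix; rewrite fg.
- by move=> f g h fg gh x Ix; rewrite fg ?gh.
- by move=> f f' g g' ff gg x Ix; rewrite ff ?gg.
- by move=> f f' ff x Ix; rewrite ff.
- by move=> a f f' ff x Ix; apply: ff; apply: idealMl.
- by move=> f g h x _; rewrite addrA.
- by move=> f g x _; rewrite addrC.
- by move=> f x _; rewrite add0r.
- by move=> f x _; rewrite addNr.
- by move=> a b f x _; rewrite (mulrA (b : A)).
- by move=> f x _; rewrite mul1r.
- by [].
- by move=> f a b x Ix; rewrite mulrDl (lin_onD (svalP f)) //; apply: idealMl.
move=> H [pi [pis pieq piD piZ]].
pose u q := sval (cid (pis q)).
have uK q : pi (u q) = q by rewrite /u; case: cid.
have evpi f x : I x -> sval (u (pi f)) x = sval f x.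
  by move=> Ix; have /pieq -> : pi (u (pi f)) = pi f.
exists H, (fun h => sval (u h)); split.
- by move=> h; apply: svalP.
- by move=> h h' x Ix; rewrite -{1}(uK h) -{1}(uK h') -piD evpi.
- by move=> h a x Ix; rewrite -{1}(uK h) /act -piZ evpi.
- by move=> f fl; exists (pi (exist _ f fl)) => x Ix; rewrite evpi.
- by move=> h h' hh; rewrite -(uK h) -(uK h'); apply/pieq.
Qed.

(** Besides the balancing law [balA], linearity for the right action on [I] is required in [balM]:
    maps out of the tensor product have to be module morphisms, not just additive. *)
Record balanced X P (b : X -> A -> P) : Prop := Balanced {
  balDl : forall m n x, I x -> b (m + n) x = b m x + b n x;
  balDr : forall m x y, I x -> I y -> b m (x + y) = b m x + b m y;
  balA : forall m a x, I x -> b (m *> a) x = b m (a * x);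
  balM : forall m x a, I x -> b m (x * a) = b m x *> a }.

(* [T] is the tensor product of [X] with [I] over [A], built from formal sums of
   pairs; two of them are identified when every balanced map does so, which
   avoids generating the relation. *)
Lemma tensor_exists X :
  exists (T : lmodType A^c) (t : X -> A -> T),
  [/\ balanced t,
      forall P (b : X -> A -> P), balanced b ->
        exists h : @mor (Mod A) T P, forall m x, I x -> ap h (t m x) = b m x
    & forall S : T -> Prop, S 0 -> (forall u v, S u -> S v -> S (u + v)) ->
        (forall m x, I x -> S (t m x)) -> forall u, S u].
Proof.
pose car := seq (X * {x : A | I x}).
pose ev P (b : X -> A -> P) (l : car) : P := \sum_(p <- l) b p.1 (sval p.2).
have evD P (b : X -> A -> P) l l' : ev P b (l ++ l') = ev P b l + ev P b l'.
  by rewrite /ev big_cat.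
pose opp (l : car) : car := map (fun p => (- p.1, p.2)) l.
pose scale (a : A^c) (l : car) : car :=
  map (fun p => (p.1, exist _ _ (idealMr I2 a (svalP p.2)))) l.
have b0 P (b : X -> A -> P) x : balanced b -> I x -> b 0 x = 0.
  by move=> bb Ix; apply: (addrI (b 0 x)); rewrite -(balDl bb) // !addr0.
have bN P (b : X -> A -> P) m x : balanced b -> I x -> b (- m) x = - b m x.
  move=> bb Ix; apply: (addIr (b m x)).
  by rewrite -(balDl bb) // !addNr b0.
have evN P (b : X -> A -> P) l : balanced b -> ev P b (opp l) = - ev P b l.
  move=> bb; rewrite /ev big_map -sumrN; apply: eq_bigr => p _ /=.
  by rewrite bN //; apply: svalP.
have evZ P (b : X -> A -> P) a l : balanced b -> ev P b (scale a l) = ev P b l *> a.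
  move=> bb; rewrite /ev big_map /act scaler_sumr; apply: eq_bigr => p _ /=.
  by rewrite (balM bb) //; apply: svalP.
have [] := @setoid_module_exists A^c car
  (fun l l' => forall P (b : X -> A -> P), balanced b -> ev P b l = ev P b l')
  cat [::] opp scale _; first split=> /=.
- by [].
- by move=> l l' ll P b bb; rewrite ll.
- by move=> l l' l'' ll ll' P b bb; rewrite ll ?ll'.
- by move=> l l' k k' ll kk P b bb; rewrite !evD ll ?kk.
- by move=> l l' ll P b bb; rewrite !evN ?ll.
- by move=> a l l' ll P b bb; rewrite !evZ ?ll.
- by move=> l l' l'' P b bb; rewrite !evD addrA.
- by move=> l l' P b bb; rewrite !evD addrC.
- by [].
- by move=> l P b bb; rewrite !evD evN // addNr /ev big_nil.
- by move=> a c l P b bb; rewrite !evZ // /act scalerA.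
- by move=> l P b bb; rewrite !evZ // /act scale1r.
- by move=> a l l' P b bb; rewrite !evD !evZ // !evD actDl.
- by move=> l a c P b bb; rewrite !evD !evZ // /act scalerDl.
move=> T [pi [pis pieq piD piZ]].
(* Outside [I] the value 0 is a default about which [balanced] says nothing. *)
pose t m x : T := if pselect (I x) is left Ix then pi [:: (m, exist _ x Ix)] else 0.
have tE m x (Ix : I x) : t m x = pi [:: (m, exist _ x Ix)].
  by rewrite /t; case: pselect => // Ix'; rewrite (Prop_irrelevance Ix Ix').
have ev1 P (b : X -> A -> P) m p : ev P b [:: (m, p)] = b m (sval p).
  by rewrite /ev big_seq1.
have pi0 : pi [::] = 0.
  by apply: (addrI (pi [::])); rewrite -piD /= addr0.
exists T, t; split.
- split=> [m n x Ix|m x y Ix Iy|m a x Ix|m x a Ix].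
  + rewrite !(tE _ _ Ix) -piD; apply/pieq => P b bb.
    by rewrite evD !ev1 /= balDl.
  + rewrite (tE _ _ Ix) (tE _ _ Iy) (tE _ _ (idealD I2 Ix Iy)) -piD.
    by apply/pieq => P b bb; rewrite evD !ev1 /= balDr.
  + rewrite (tE _ _ Ix) (tE _ _ (idealMl I2 a Ix)).
    by apply/pieq => P b bb; rewrite !ev1 /= balA.
  + rewrite (tE _ _ Ix) (tE _ _ (idealMr I2 a Ix)) /act -piZ.
    by apply/pieq => P b bb; rewrite evZ // !ev1 /= balM.
- move=> P b bb; pose u q := sval (cid (pis q)).
  have uK q : pi (u q) = q by rewrite /u; case: cid.
  have evu l : ev P b (u (pi l)) = ev P b l.
    by have /pieq -> : pi (u (pi l)) = pi l.
  have [x y|x a|h hE] := @hom_exists A T P (fun q => ev P b (u q)).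
  + by rewrite -{1}(uK x) -{1}(uK y) -piD evu evD.
  + by rewrite -{1}(uK x) /act -piZ evu evZ.
  by exists h => m x Ix; rewrite hE (tE _ _ Ix) evu ev1.
- move=> S S0 SD St u; have [l <-] := pis u.
  elim: l => [|[m [x Ix]] l IHl]; first by rewrite pi0.
  by rewrite -cat1s piD; apply: SD => //; rewrite -tE; apply: St.
Qed.

End Ideal.
End Constructions.

(** * Idempotent ideals and TTF-triples *)

Section IdempotentIdealsTTF.
Variable A : pzRingType.
Implicit Types M N P Q K W X : lmodType A^c.

Lemma mono_inj_hom M N (f : @mor (Mod A) M N) : mono f -> inj_hom f.
Proof.
move=> /mono0P fm; have [K [k [_ kE]]] := sub_exists (submodule_ker f).
have k0 : k = 0 by apply: fm; apply: hom_ext => x; rewrite apc; apply/kE; exists x.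
by move=> x /kE [y <-]; rewrite k0.
Qed.

Lemma epi_surj_hom M N (f : @mor (Mod A) M N) : epi f -> surj_hom f.
Proof.
move=> /epi0P fe; have [Q [q [_ qE]]] := quot_exists (submodule_im f).
have q0 : q = 0 by apply: fe; apply: hom_ext => x; rewrite apc; apply/qE; exists x.
by move=> y; apply/qE; rewrite q0.
Qed.

Lemma short_exact_inj M N P (f : @mor (Mod A) M N) (g : @mor (Mod A) N P) :
  short_exact f g -> inj_hom f.
Proof. by move=> [kf _]; apply: mono_inj_hom (kernel_mono kf). Qed.

Lemma short_exact_surj M N P (f : @mor (Mod A) M N) (g : @mor (Mod A) N P) :
  short_exact f g -> surj_hom g.
Proof.
move=> [_ cg]; apply: epi_surj_hom.
exact: (@kernel_mono (opcat (Mod A)) P N M g f cg).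
Qed.

Lemma short_exact_mid M N P (f : @mor (Mod A) M N) (g : @mor (Mod A) N P) n :
  short_exact f g -> ap g n = 0 -> exists m, ap f m = n.
Proof.
move=> [[_ fU] _] gn0; have [K [k [_ kE]]] := sub_exists (submodule_ker g).
have [|h [hE _]] := fU K k.
  by apply: hom_ext => x; rewrite apc; apply/kE; exists x.
by have /kE [x <-] := gn0; exists (ap h x); rewrite -apc hE.
Qed.

Lemma mod_short_exact M N P (f : @mor (Mod A) M N) (g : @mor (Mod A) N P) :
  inj_hom f -> surj_hom g -> (forall n, ap g n = 0 <-> exists m, ap f m = n) ->
  short_exact f g.
Proof.
by move=> fi gs fg; split; [apply: mod_is_kernel|apply: mod_is_cokernel].
Qed.

Definition regular : lmodType A^c := (A^c)^o.

Lemma regularE (a b : A) : (a : regular) *> b = a * b.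
Proof. by []. Qed.

Lemma orbit_hom M (m : M) : exists f : @mor (Mod A) regular M,
  forall a : A, ap f a = m *> a.
Proof.
by apply: (@hom_exists A regular M (fun a : A => m *> a)) => [x y|x a];
  rewrite ?actDr ?regularE ?actA.
Qed.

(** * The three classes of modules attached to an ideal *)

Section IdealClasses.
Variable I : A -> Prop.

(* The submodule [M I]. *)
Definition ideal_span M (m : M) : Prop := forall S : M -> Prop,
  submodule S -> (forall n x, I x -> S (n *> x)) -> S m.
Definition ideal_full M : Prop := forall m : M, ideal_span m.
Definition ideal_killed M : Prop := forall (m : M) x, I x -> m *> x = 0.
Definition ideal_torsion M (m : M) : Prop := forall x, I x -> m *> x = 0.
Definition ideal_torsion_free M : Prop := forall m : M, ideal_torsion m -> m = 0.

Lemma submodule_span M : submodule (@ideal_span M).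
Proof.
split=> [S Ss _|x y Sx Sy S Ss SI|x a Sx S Ss SI]; first exact: submod0.
  by apply: submodD => //; [apply: Sx|apply: Sy].
by apply: submodM => //; apply: Sx.
Qed.

Lemma span_act M (m : M) x : I x -> ideal_span (m *> x).
Proof. by move=> Ix S Ss SI; apply: SI. Qed.

Lemma span_hom M N (f : @mor (Mod A) M N) m :
  ideal_span m -> ideal_span (ap f m).
Proof.
move=> sm; apply: (sm (fun m => ideal_span (ap f m))) => [|n x Ix]; last first.
  by rewrite apM; apply: span_act.
have Ss := submodule_span N; split=> [|x y|x a].
- by rewrite ap0; apply: (submod0 Ss).
- by rewrite apD; apply: (submodD Ss).
- by rewrite apM; apply: (submodM Ss).
Qed.

Lemma span_killed M N (f : @mor (Mod A) M N) m :
  ideal_killed N -> ideal_span m -> ap f m = 0.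
Proof.
move=> kN sm; apply: (sm (fun m => ap f m = 0)); first exact: submodule_ker.
by move=> n x Ix; rewrite apM kN.
Qed.

Lemma full_surj M N (f : @mor (Mod A) M N) :
  surj_hom f -> ideal_full M -> ideal_full N.
Proof. by move=> fs gM y; have [x <-] := fs y; apply: span_hom. Qed.

Lemma killed_inj M N (f : @mor (Mod A) M N) :
  inj_hom f -> ideal_killed N -> ideal_killed M.
Proof. by move=> fi kN m x Ix; apply: fi; rewrite apM kN. Qed.

Lemma killed_surj M N (f : @mor (Mod A) M N) :
  surj_hom f -> ideal_killed M -> ideal_killed N.
Proof. by move=> fs kM y x Ix; have [m <-] := fs y; rewrite -apM kM // ap0. Qed.

Lemma torsion_free_inj M N (f : @mor (Mod A) M N) :
  inj_hom f -> ideal_torsion_free N -> ideal_torsion_free M.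
Proof.
by move=> fi tN m tm; apply/fi/tN => x Ix; rewrite -apM tm ?ap0.
Qed.

Lemma strict_full : @strict (Mod A) ideal_full.
Proof. by move=> M N [f fI]; apply: full_surj (iso_surj fI). Qed.

Lemma strict_killed : @strict (Mod A) ideal_killed.
Proof. by move=> M N [f fI]; apply: killed_surj (iso_surj fI). Qed.

Lemma strict_torsion_free : @strict (Mod A) ideal_torsion_free.
Proof. by move=> M N /iso_sym [f fI]; apply: torsion_free_inj (iso_inj fI). Qed.

Lemma killed_surj_span M Q (q : @mor (Mod A) M Q) :
  surj_hom q -> (forall m, ideal_span m -> ap q m = 0) -> ideal_killed Q.
Proof.
by move=> qs qE y x Ix; have [m <-] := qs y; rewrite -apM qE //; apply: span_act.
Qed.

Hypothesis I2 : two_sided_ideal I.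

Lemma submodule_torsion M : submodule (@ideal_torsion M).
Proof.
split=> [x _|m n tm tn x Ix|m a tm x Ix]; first exact: act0l.
  by rewrite actDl tm ?tn ?addr0.
by rewrite actA tm //; apply: idealMl.
Qed.

Hypothesis Iidem : forall a, ideal_mul I I a <-> I a.

(** Idempotence in the form used for modules: since [x] is a sum of products from [I], membership of
    [m *> x] reduces to such products. *)
Lemma idem_ind M (m : M) (S : M -> Prop) x : submodule S ->
  (forall y z, I y -> I z -> S (m *> y *> z)) -> I x -> S (m *> x).
Proof.
move=> Ss SI /Iidem [n [y [z [yz ->]]]]; rewrite act_sumr.
by apply: submod_sum => // i; have [? ?] := yz i; rewrite -actA; apply: SI.
Qed.

Lemma idem_torsion M (m : M) :
  (forall x y, I x -> I y -> m *> x *> y = 0) -> ideal_torsion m.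
Proof.
move=> m0 x; apply: (@idem_ind M m (fun n => n = 0)) => //.
by split=> [//|u v -> ->|u a ->]; rewrite ?addr0 ?act0l.
Qed.

(** This is [(M I) I = M I]: a generator [n (y z)] is [(n y) z] with [n y] already in [M I]. The set
    [S] below is the image of [K I] in [M]. *)
Lemma full_span M K (k : @mor (Mod A) K M) :
  inj_hom k -> (forall m, ideal_span m <-> exists x, ap k x = m) -> ideal_full K.
Proof.
move=> ki kE; pose S (m : M) := exists u, ap k u = m /\ ideal_span u.
have SS : submodule S.
  have Ss := submodule_span K; split.
  - by exists 0; split; [exact: ap0|exact: (submod0 Ss)].
  - move=> _ _ [u [<- su]] [v [<- sv]].
    by exists (u + v); rewrite apD; split=> //; apply: (submodD Ss).
  - move=> _ a [u [<- su]].
    by exists (u *> a); rewrite apM; split=> //; apply: (submodM Ss).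
have im (m : M) : ideal_span m -> S m.
  move=> sm; apply: (sm S) => // n x Ix; apply: (idem_ind SS) => // y z Iy Iz.
  have /kE [u uE] : ideal_span (n *> y) by apply: span_act.
  by exists (u *> z); rewrite apM uE; split=> //; apply: span_act.
move=> u; have [|v [vE sv]] := im (ap k u); first by apply/kE; exists u.
by rewrite -(inj_homP ki vE).
Qed.

(** If the class of [m] is torsion, then [m I] is torsion in [M], so [m I I = 0], and [m] is torsion
    by idempotence. *)
Lemma torsion_free_quot M Q (q : @mor (Mod A) M Q) :
  surj_hom q -> (forall m, ap q m = 0 <-> ideal_torsion m) ->
  ideal_torsion_free Q.
Proof.
move=> qs qE y ty; have [m mE] := qs y; rewrite -mE; apply/qE.
apply: idem_torsion => x z Ix Iz.
have /qE : ap q (m *> x) = 0 by rewrite apM mE ty.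
exact.
Qed.

Lemma full_killed_torsion_pair :
  @torsion_pair (Mod A) ideal_full ideal_killed.
Proof.
split; [exact: strict_full|exact: strict_killed| |].
  by move=> M N gM kN f; apply: hom_ext => m; apply: span_killed.
move=> M; have [K [k [ki kE]]] := sub_exists (submodule_span M).
have [Q [q [qs qE]]] := quot_exists (submodule_span M).
exists K, Q, k, q; split.
- exact: full_span kE.
- by apply: killed_surj_span qs _ => m /qE.
- by apply: mod_short_exact => // m; rewrite -kE.
Qed.

Lemma killed_torsion_free_torsion_pair :
  @torsion_pair (Mod A) ideal_killed ideal_torsion_free.
Proof.
split; [exact: strict_killed|exact: strict_torsion_free| |].
  move=> M N kM tN f; apply: hom_ext => m; apply: tN => x Ix.
  by rewrite -apM kM // ap0.
move=> M; have [K [k [ki kE]]] := sub_exists (submodule_torsion M).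
have [Q [q [qs qE]]] := quot_exists (submodule_torsion M).
exists K, Q, k, q; split.
- move=> u x Ix; apply: ki; rewrite apM.
  by have /kE -> : exists v, ap k v = ap k u by exists u.
- exact: torsion_free_quot qE.
- by apply: mod_short_exact => // m; rewrite -kE.
Qed.

End IdealClasses.

Definition annihilator (Y : Mod A -> Prop) (a : A) : Prop :=
  forall M, Y M -> forall m : M, m *> a = 0.

Lemma annihilator_two_sided Y : two_sided_ideal (annihilator Y).
Proof.
split=> [M _ m|x y ax ay M YM m|a x ax M YM m|x a ax M YM m].
- exact: act0r.
- by rewrite actDr ax ?ay ?addr0.
- by rewrite -actA ax.
- by rewrite -actA ax // act0l.
Qed.

Lemma annihilator_killed (I : A -> Prop) : two_sided_ideal I ->
  annihilator (ideal_killed I) = I.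
Proof.
move=> I2; apply/funext => a; apply/propext; split=> [ann_a|Ia M kM m]; last exact: kM.
have [|Q [q [qs qE]]] := @quot_exists A regular I.
  by split; [exact: (ideal0 I2)|exact: (idealD I2)|move=> x b; exact: (idealMr I2)].
(* The test module is [A / I]: it is killed by [I], and the annihilator of the class of 1 is [I]. *)
apply/(qE a); rewrite -[a]mul1r -regularE apM; apply: ann_a => y x Ix.
have [b <-] := qs y; rewrite -apM; apply/qE; exact: (idealMl I2).
Qed.

Lemma ideal_mulD (I J : A -> Prop) a b :
  ideal_mul I J a -> ideal_mul I J b -> ideal_mul I J (a + b).
Proof.
move=> [n [x [y [xy ->]]]] [n' [x' [y' [xy' ->]]]].
exists (n + n')%N, (fun k => match split k with inl i => x i | inr j => x' j end),
  (fun k => match split k with inl i => y i | inr j => y' j end); split.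
  by move=> k; case: split.
rewrite big_split_ord /=; congr (_ + _); apply: eq_bigr => i _.
  by case: splitP => j /= E; [have -> : i = j by exact: val_inj|
    have := ltn_ord i; rewrite E ltnNge leq_addr].
by case: splitP => j /= E; [have := ltn_ord j; rewrite -E ltnNge leq_addr|
  move/addnI/val_inj: E => ->].
Qed.

(** * Classes of modules recovered from their annihilator *)

Section AnnihilatorClass.
Variable Y : Mod A -> Prop.
(** [Ygen] combines closure under quotients and arbitrary sums without forming a direct sum. In
    [Yreg] the kernel of [q] lies in the annihilator, and contains it because [Q] is in [Y], so [Q]
    is [A / ann Y]. These properties are shared by TTF-triples and recollements. *)
Hypothesis Ygen : forall M,
  (forall m : M, exists N, Y N /\ exists (f : @mor (Mod A) N M) n, ap f n = m) ->
  Y M.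
Hypothesis Yreg : exists Q, Y Q /\ exists q : @mor (Mod A) regular Q,
  surj_hom q /\ forall a : A, ap q a = 0 -> annihilator Y a.
Hypothesis Yext : forall K M N (k : @mor (Mod A) K M) (p : @mor (Mod A) M N),
  Y K -> Y N -> short_exact k p -> Y M.
Let J := annihilator Y.

(** If [J] kills [M], each orbit map [a |-> m a] factors through [Q], so every element of [M] is in
    the image of a member of [Y]. *)
Lemma annihilator_classP M : Y M <-> ideal_killed J M.
Proof.
split=> [YM m x|kM]; first exact.
apply: Ygen => m; have [Q [YQ [q [qs qJ]]]] := Yreg.
have [f fE] := orbit_hom m.
have [a /qJ Ja|g gq] := factor_surj qs (f := f); first by rewrite fE kM.
exists Q; split=> //; exists g, (ap q (1 : A)).
by rewrite -apc gq fE act1.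
Qed.

(** The module [A / J^2] is an extension of [Q = A / J] by [J / J^2]. Both are in [Y], hence so is
    [A / J^2]; being in [Y] it is killed by [J], and evaluating at the class of 1 puts [J] inside
    [J^2]. *)
Lemma annihilator_idem a : ideal_mul J J a <-> J a.
Proof.
have J2 := annihilator_two_sided Y; split=> [[n [x [y [xy ->]]]] M YM m|Ja].
  by rewrite act_sumr big1 // => i _; rewrite -actA; apply: (xy i).2.
have Js : submodule (ideal_mul J J : regular -> Prop).
  split=> [|x y|_ b [n [x [y [xy ->]]]]].
  - by exists 0%N, (fun _ => 0), (fun _ => 0); rewrite big_ord0; split=> [[]|].
  - exact: ideal_mulD.
  - rewrite regularE mulr_suml; exists n, x, (fun i => y i * b); split=> [i|].
      by have [? ?] := xy i; split=> //; apply: (idealMr J2).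
    by apply: eq_bigr => i _; rewrite mulrA.
have [M [pi [pis piE]]] := quot_exists Js.
have [Q [YQ [q [qs qJ]]]] := Yreg.
have [b /piE [n [x [y [xy ->]]]]|p pE] := factor_surj pis (f := q).
  rewrite -[X in ap q X]mul1r -regularE apM act_sumr big1 // => i _.
  by rewrite -actA; apply: (xy i).2.
have [K [k [ki kE]]] := sub_exists (submodule_ker p).
(* [K] is [J / J^2]: its elements are classes of some [b] with [q b = 0], so [b] is in [J], and
   [b x] is in [J^2] for [x] in [J]. *)
have YK : Y K.
  apply/annihilator_classP => u x Jx; apply: ki; rewrite apM.
  have [b bE] := pis (ap k u); rewrite -bE -apM; apply/piE.
  have /kE : exists v, ap k v = ap k u by exists u.
  rewrite -bE -apc pE => /qJ Jb.
  by exists 1%N, (fun _ => b), (fun _ => x); rewrite big_ord1.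
have YM : Y M.
  apply: Yext YK YQ (mod_short_exact ki _ kE) => y.
  by have [b <-] := qs y; exists (ap pi b); rewrite -apc pE.
by apply/piE; rewrite -[a]mul1r -regularE apM; apply: Ja.
Qed.

Definition annihilator_idempotent_ideal : idempotent_ideal A :=
  IdempotentIdeal (annihilator_two_sided Y) annihilator_idem.

End AnnihilatorClass.

Lemma idempotent_ideal_eq (I J : idempotent_ideal A) :
  (I : A -> Prop) = J -> I = J.
Proof.
case: I J => [I I2 Ii] [J J2 Ji] /= E; case: _ / E in J2 Ji *.
by rewrite (Prop_irrelevance I2 J2) (Prop_irrelevance Ii Ji).
Qed.

(** * The ideal of a TTF-triple *)

Section TTF.
Variable t : ttf_triple (Mod A).
Let X := ttf_X t.
Let Y := ttf_Y t.
Let Z := ttf_Z t.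
Let XY : torsion_pair X Y := ttf_XY t.
Let YZ : torsion_pair Y Z := ttf_YZ t.

(** Maps from [Y] to [M] die in the torsion-free quotient of [M] for the pair [(Y, Z)]; their
    images, which cover [M], thus lie in its torsion part. *)
Lemma ttf_gen M :
  (forall m : M, exists N, Y N /\ exists (f : @mor (Mod A) N M) n, ap f n = m) ->
  Y M.
Proof.
move=> Mgen; have [YM [ZM [i [p [YYM ZZM ip]]]]] := tp_exact YZ M.
apply: (tp_strictl YZ _ YYM); exists i.
apply: inj_surj_iso (short_exact_inj ip) _ => m; apply: (short_exact_mid ip).
have [N [YN [f [n <-]]]] := Mgen m.
by rewrite -apc (tp_hom0 YZ YN ZZM (p \c f)).
Qed.

(** [Q] is the torsion-free quotient of [A] for [(X, Y)]: an orbit map into a member of [Y] vanishes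
    on the torsion part, which therefore annihilates [Y]. *)
Lemma ttf_reg : exists Q, Y Q /\ exists q : @mor (Mod A) regular Q,
  surj_hom q /\ forall a : A, ap q a = 0 -> annihilator Y a.
Proof.
have [XA [YA [i [p [XXA YYA ip]]]]] := tp_exact XY regular.
exists YA; split=> //; exists p; split; first exact: short_exact_surj ip.
move=> a /(short_exact_mid ip) [x xE] M YM m.
have [f fE] := orbit_hom m.
by rewrite -fE -xE -apc (tp_hom0 XY XXA YM (f \c i)).
Qed.

(** The torsion part of [M] for [(X, Y)] maps to zero in [N], so its inclusion lifts to [K], where
    it is zero again. *)
Lemma ttf_ext K M N (k : @mor (Mod A) K M) (p : @mor (Mod A) M N) :
  Y K -> Y N -> short_exact k p -> Y M.
Proof.
move=> YK YN kp; have [XM [YM [i [r [XXM YYM ir]]]]] := tp_exact XY M.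
have [|g [gE _]] := kp.1.2 _ i; first exact: (tp_hom0 XY XXM YN).
have i0 : i = 0 by rewrite -gE (tp_hom0 XY XXM YK g) mcomp0r.
apply: (tp_strictr XY _ YYM); apply: iso_sym; exists r.
apply: inj_surj_iso (short_exact_surj ir) => m /(short_exact_mid ir) [x <-].
by rewrite i0.
Qed.

Definition ttf_ideal : idempotent_ideal A :=
  annihilator_idempotent_ideal ttf_gen ttf_reg ttf_ext.

Lemma ttf_YP M : Y M <-> ideal_killed ttf_ideal M.
Proof. exact: (annihilator_classP ttf_gen ttf_reg). Qed.

Lemma ttf_XP M : X M <-> ideal_full ttf_ideal M.
Proof.
split=> [XM m|fM].
  have [Q [q [qs qE]]] := quot_exists (submodule_span ttf_ideal M).
  apply/qE; rewrite (tp_hom0 XY XM _ q) //.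
  by apply/ttf_YP/(killed_surj_span qs) => n /qE.
have [XM [YM [i [p [XXM /ttf_YP YYM ip]]]]] := tp_exact XY M.
apply: (tp_strictl XY _ XXM); exists i.
apply: inj_surj_iso (short_exact_inj ip) _ => m; apply: (short_exact_mid ip).
exact: span_killed YYM (fM m).
Qed.

Lemma ttf_ZP M : Z M <-> ideal_torsion_free ttf_ideal M.
Proof.
have I2 := ideal_two_sided ttf_ideal.
split=> [ZM m tm|tM].
  have [K [k [ki kE]]] := sub_exists (submodule_torsion I2 M).
  have [x <-] := (kE m).1 tm; rewrite (tp_hom0 YZ _ ZM k) //.
  apply/ttf_YP => u y Iy; apply: ki; rewrite apM.
  by have /kE -> : exists v, ap k v = ap k u by exists u.
have [YM [ZM [i [p [/ttf_YP YYM ZZM ip]]]]] := tp_exact YZ M.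
apply: (tp_strictr YZ _ ZZM); apply: iso_sym; exists p.
apply: inj_surj_iso (short_exact_surj ip) => m /(short_exact_mid ip) [x <-].
by apply: tM => a Ia; rewrite -apM YYM // ap0.
Qed.

End TTF.

Definition ideal_ttf (I : idempotent_ideal A) : ttf_triple (Mod A) :=
  TTFTriple (full_killed_torsion_pair (@ideal_idem A I))
    (killed_torsion_free_torsion_pair (ideal_two_sided I) (@ideal_idem A I)).

Lemma ttf_triple_eq (t u : ttf_triple (Mod A)) :
  ttf_X t = ttf_X u -> ttf_Y t = ttf_Y u -> ttf_Z t = ttf_Z u -> t = u.
Proof.
case: t u => [X Y Z XY YZ] [X' Y' Z' XY' YZ'] /= EX EY EZ.
case: _ / EX in XY' *; case: _ / EY in XY' YZ' *; case: _ / EZ in YZ' *.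
by rewrite (Prop_irrelevance XY XY') (Prop_irrelevance YZ YZ').
Qed.

Lemma ttf_idealK : cancel ttf_ideal ideal_ttf.
Proof.
by move=> t; apply: ttf_triple_eq; apply/funext => M; apply/propext => /=;
  rewrite (ttf_XP, ttf_YP, ttf_ZP).
Qed.

Lemma ideal_ttfK : cancel ideal_ttf ttf_ideal.
Proof.
move=> I; apply: idempotent_ideal_eq; exact: annihilator_killed (ideal_two_sided I).
Qed.

End IdempotentIdealsTTF.

(** * From recollements to idempotent ideals *)

Section RecollementIdeal.
Variable A : pzRingType.
Implicit Types M N P Q K : lmodType A^c.
Variable R : recollement (Mod A).
Let Y : Mod A -> Prop := ker_functor (j_ustar R).

Lemma mod_kernel_exists M N (f : @mor (Mod A) M N) :
  exists K (k : @mor (Mod A) K M), is_kernel k f.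
Proof.
have [K [k [ki kE]]] := sub_exists (submodule_ker f).
by exists K, k; apply: mod_is_kernel.
Qed.

Lemma mod_cokernel_exists M N (f : @mor (Mod A) M N) :
  exists Q (q : @mor (Mod A) N Q), is_cokernel q f.
Proof.
have [Q [q [qs qE]]] := quot_exists (submodule_im f).
by exists Q, q; apply: mod_is_cokernel.
Qed.

(** Having adjoints on both sides, [j_ustar] is exact: kernels come from [j_lshriek], cokernels,
    next, from [j_lstar]. *)
Lemma j_ustar_kernel K M N (k : @mor (Mod A) K M) (f : @mor (Mod A) M N) :
  is_kernel k f -> is_kernel (fmap (j_ustar R) k) (fmap (j_ustar R) f).
Proof.
exact: (right_adjoint_kernel (adj_j_lshriek_ustar R) (@j_lshriek_additive _ R)
  (@j_ustar_additive _ R)).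
Qed.

Lemma j_ustar_cokernel M N Q (q : @mor (Mod A) N Q) (f : @mor (Mod A) M N) :
  is_cokernel q f -> is_cokernel (fmap (j_ustar R) q) (fmap (j_ustar R) f).
Proof.
exact: (left_adjoint_cokernel (adj_j_ustar_lstar R) (@j_ustar_additive _ R)
  (@j_lstar_additive _ R)).
Qed.

Lemma ker_j_inj M N (f : @mor (Mod A) M N) : inj_hom f -> Y N -> Y M.
Proof.
move=> fi; have [Q [q [qs qE]]] := quot_exists (submodule_im f).
have /j_ustar_kernel/kernel_mono : is_kernel f q by apply: mod_is_kernel.
exact: mono_zero_source.
Qed.

Lemma ker_j_surj M N (f : @mor (Mod A) M N) : surj_hom f -> Y M -> Y N.
Proof.
move=> fs; have [K [k [ki kE]]] := sub_exists (submodule_ker f).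
have /j_ustar_cokernel/cokernel_epi : is_cokernel f k by apply: mod_is_cokernel.
exact: epi_zero_target.
Qed.

Lemma ker_j_i_lstar B : Y (i_lstar R B).
Proof. by apply/im_i_ker_j; exists B; exists (idm _); apply: is_iso_id. Qed.

Lemma ker_j_reflection M : exists N (u : @mor (Mod A) M N),
  Y N /\ forall P (f : @mor (Mod A) M P), Y P -> exists g, g \c u = f.
Proof.
have [eta [_ etab]] := left_adjoint_unit (adj_i_ustar_lstar R).
exists (i_lstar R (i_ustar R M)), (eta M); split; first exact: ker_j_i_lstar.
move=> P f /im_i_ker_j [B [e [e' [_ ee']]]].
have [psi _ psiK] := etab M B.
exists (e \c fmap (i_lstar R) (psi (e' \c f))).
by rewrite -mcompA psiK mcompA ee' mcomp1m.
Qed.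

Lemma ker_j_coreflection M : exists N (u : @mor (Mod A) N M),
  Y N /\ forall P (f : @mor (Mod A) P M), Y P -> exists g, u \c g = f.
Proof.
have [eps [_ epsb]] := left_adjoint_counit (adj_i_lstar_ushriek R).
exists (i_lstar R (i_ushriek R M)), (eps M); split; first exact: ker_j_i_lstar.
move=> P f /im_i_ker_j [B [e [e' [_ ee']]]].
have [psi _ psiK] := epsb B M.
exists (fmap (i_lstar R) (psi (f \c e)) \c e').
by rewrite mcompA psiK -mcompA ee' mcompm1.
Qed.

(** The right adjoint [i_ushriek] replaces closure under sums: all maps from [Y] to [M] factor
    through the single coreflection [u], which is therefore surjective. *)
Lemma ker_j_gen M :
  (forall m : M, exists N, Y N /\ exists (f : @mor (Mod A) N M) n, ap f n = m) ->
  Y M.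
Proof.
move=> Mgen; have [N [u [YN uU]]] := ker_j_coreflection M.
apply: ker_j_surj (u) _ YN => m; have [P [YP [f [n <-]]]] := Mgen m.
by have [g <-] := uU P f YP; exists (ap g n).
Qed.

(** [Q] is the image of the reflection [u] of [A], a submodule of a member of [Y]. Orbit maps into
    [Y] factor through [u], so the kernel of [u] annihilates [Y]. *)
Lemma ker_j_reg : exists Q, Y Q /\ exists q : @mor (Mod A) (regular A) Q,
  surj_hom q /\ forall a : A, ap q a = 0 -> annihilator Y a.
Proof.
have [N [u [YN uU]]] := ker_j_reflection (regular A).
have [Q [q [qs qE]]] := quot_exists (submodule_ker u).
have [|v vq] := factor_surj qs (f := u); first by move=> x /qE.
exists Q; split.
  apply: ker_j_inj (v) _ YN => y; have [x <-] := qs y.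
  by rewrite -apc vq => /qE.
exists q; split=> // a /qE ua0 M YM m; have [f fE] := orbit_hom m.
by have [g gu] := uU M f YM; rewrite -fE -gu apc ua0 ap0.
Qed.

Lemma ker_j_ext K M N (k : @mor (Mod A) K M) (p : @mor (Mod A) M N) :
  Y K -> Y N -> short_exact k p -> Y M.
Proof.
move=> YK YN [/j_ustar_kernel kp _].
exact: mono_zero_source (mono_zero_kernel kp YK) YN.
Qed.

Definition recollement_ideal : idempotent_ideal A :=
  annihilator_idempotent_ideal ker_j_gen ker_j_reg ker_j_ext.

Lemma ker_jP M : Y M <-> ideal_killed recollement_ideal M.
Proof. exact: (annihilator_classP ker_j_gen ker_j_reg). Qed.

End RecollementIdeal.

(** * Recollements with the same kernel *)

Section RecollementEquiv.
Variable A : pzRingType.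
Implicit Types (R S : recollement (Mod A)).

Definition same_kernel R S :=
  forall M, ker_functor (j_ustar R) M <-> ker_functor (j_ustar S) M.

(** By exactness, [fmap j_ustar f] is invertible exactly when [j_ustar] kills the module kernel and
    cokernel of [f], a condition on the common kernel class. *)
Lemma j_ustar_iso R S M N (f : @mor (Mod A) M N) : same_kernel R S ->
  is_iso (fmap (j_ustar R) f) -> is_iso (fmap (j_ustar S) f).
Proof.
move=> RS fI; apply: abelian_mono_epi_iso; first exact: rC_abelian.
  have [K [k kf]] := mod_kernel_exists f.
  apply: mono_zero_kernel (j_ustar_kernel S kf) _; apply/RS.
  exact: kernel_of_mono (j_ustar_kernel R kf) (is_iso_mono fI).
have [Q [q qf]] := mod_cokernel_exists f.
apply: epi_zero_cokernel (j_ustar_cokernel S qf) _; apply/RS.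
exact: cokernel_of_epi (j_ustar_cokernel R qf) (is_iso_epi fI).
Qed.

(* The counit [j_! j^* M -> M] becomes invertible under [j^*], hence under any
   other [j^*] with the same kernel. *)
Lemma same_kernel_nat_iso R S : same_kernel R S ->
  nat_iso (j_ustar S \F (j_lshriek R \F j_ustar R)) (j_ustar S).
Proof.
move=> RS; have [eta [etaN etab]] := left_adjoint_unit (adj_j_lshriek_ustar R).
have etaI := (unit_fully_faithful etaN etab).1 (@j_lshriek_ff _ R).
have /(_ _)/cid epsE M : exists e : mor (j_lshriek R (j_ustar R M)) M,
    fmap (j_ustar R) e \c eta (j_ustar R M) = idm _.
  by have [psi _ psiK] := etab (j_ustar R M) M; exists (psi (idm _)).
pose eps M := sval (epsE M).
have epsK M : fmap (j_ustar R) (eps M) \c eta (j_ustar R M) = idm _.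
  exact: svalP (epsE M).
exists (fun M => fmap (j_ustar S) (eps M)); split=> [M|M N f /=].
  apply: (j_ustar_iso RS); have [g [gK Kg]] := etaI (j_ustar R M).
  suff -> : fmap (j_ustar R) (eps M) = g by exists (eta (j_ustar R M)).
  by rewrite -[LHS]mcompm1 -Kg mcompA epsK mcomp1m.
(* Naturality of the counit is checked after transposing by the adjunction. *)
rewrite -!fmapM; congr fmap; apply: (bij_inj (etab _ _)) => /=.
by rewrite !fmapM -!mcompA epsK etaN mcompA epsK mcomp1m mcompm1.
Qed.

(** The inner [j_lshriek S \F j_ustar S] is absorbed by [j_ustar R]; what remains is
    [j_ustar R \F j_lshriek R], identified with the identity by the unit. *)
Lemma same_kernel_equiv_inverse R S : same_kernel R S ->
  nat_iso ((j_ustar R \F j_lshriek S) \F (j_ustar S \F j_lshriek R))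
    (id_functor (rC R)).
Proof.
move=> RS; have SR : same_kernel S R by move=> M; split=> /RS.
apply: nat_iso_trans (nat_iso_precomp (j_lshriek R) (same_kernel_nat_iso SR)) _.
have [eta [etaN etab]] := left_adjoint_unit (adj_j_lshriek_ustar R).
have etaI := (unit_fully_faithful etaN etab).1 (@j_lshriek_ff _ R).
by apply: nat_iso_sym; exists eta.
Qed.

Lemma recollement_equivP R S : recollement_equiv R S <-> same_kernel R S.
Proof.
split=> [[Phi [PhiI [_ [Theta [ThetaE TjjP]]]]] M|RS].
  have TjjM : nat_iso (Theta \F j_ustar R) (j_ustar S).
    exact: nat_iso_trans TjjP (nat_iso_postcomp (j_ustar S) PhiI).
  rewrite /ker_functor -(equivalence_zero _ ThetaE); split.
    exact: nat_iso_zero TjjM.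
  exact: nat_iso_zero (nat_iso_sym TjjM).
have SR : same_kernel S R by move=> M; split=> /RS.
exists (id_functor _); split; first exact: nat_iso_refl.
split; first by exists (id_functor _); split; apply: nat_iso_refl.
exists (j_ustar S \F j_lshriek R); split.
  by exists (j_ustar R \F j_lshriek S); split; apply: same_kernel_equiv_inverse.
exact: same_kernel_nat_iso.
Qed.

Lemma recollement_equiv_ideal R S :
  recollement_equiv R S <-> recollement_ideal R = recollement_ideal S.
Proof.
rewrite recollement_equivP; split=> [RS|E M]; last by rewrite !ker_jP E.
apply: idempotent_ideal_eq => /=; congr annihilator.
by apply/funext => M; apply/propext/RS.
Qed.

End RecollementEquiv.

(** * From idempotent ideals to recollements *)

Section FullSubcategory.
Variables (C : category) (S : C -> Prop).

Definition full_sub : category :=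
  @Category {X : C | S X} (fun X Y => mor (sval X) (sval Y))
    (fun X => idm (sval X)) (fun X Y Z g f => g \c f)
    (fun X Y f => mcomp1m f) (fun X Y f => mcompm1 f)
    (fun W X Y Z h g f => mcompA h g f)
    (fun X Y Z g h f => mcompDl g h f) (fun X Y Z g f h => mcompDr g f h).

Definition full_sub_incl : functor full_sub C :=
  @Functor full_sub C (fun X => sval X) (fun X Y f => f)
    (fun X => erefl) (fun X Y Z g f => erefl).

Lemma full_sub_incl_additive : additive_functor full_sub_incl.
Proof. by []. Qed.

Lemma full_sub_incl_ff : fully_faithful full_sub_incl.
Proof. by move=> X Y; exists id. Qed.

Lemma full_sub_kernel (K X Y : full_sub) (k : mor K X) (f : mor X Y) :
  @is_kernel C (sval K) (sval X) (sval Y) k f -> is_kernel k f.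
Proof. by move=> [fk kU]; split=> // W g /kU. Qed.

Lemma full_sub_zero (X : full_sub) : is_zero X <-> @is_zero C (sval X).
Proof. by rewrite !is_zeroP. Qed.

End FullSubcategory.

(** * A criterion for a full subcategory of modules to be abelian *)

Section FullSubAbelian.
Variables (A : pzRingType) (S : Mod A -> Prop).
Implicit Types M N P Q K W : lmodType A^c.

(** The criterion covers killed and local modules alike. [Srefl] supplies cokernels, as reflections
    of module cokernels; [Smono] presents a mono as a kernel; [Sepi] concerns maps that are epi
    against targets in [S] only, which may fail to be surjective. *)
Hypothesis Szero : forall M, (forall m : M, m = 0) -> S M.
Hypothesis Sprod : forall M N, S M -> S N -> S (M * N : lmodType A^c)%type.
Hypothesis Sker : forall K M N (k : @mor (Mod A) K M) (f : @mor (Mod A) M N),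
  S M -> S N -> inj_hom k -> (forall m, ap f m = 0 <-> exists x, ap k x = m) ->
  S K.
Hypothesis Srefl : forall M, exists N (r : @mor (Mod A) M N), S N /\
  forall W (g : @mor (Mod A) M W), S W -> exists! h : @mor (Mod A) N W, h \c r = g.
Hypothesis Smono : forall M N (f : @mor (Mod A) M N), S M -> S N -> inj_hom f ->
  exists Q (g : @mor (Mod A) N Q), S Q /\
    forall n, ap g n = 0 <-> exists m, ap f m = n.
Hypothesis Sepi : forall M N (f : @mor (Mod A) M N), S M -> S N ->
  (forall W (g : @mor (Mod A) N W), S W -> g \c f = 0 -> g = 0) ->
  forall W (g : @mor (Mod A) M W), S W ->
  (forall m, ap f m = 0 -> ap g m = 0) -> exists h, h \c f = g.

Lemma biproduct_exists M N : exists i1 i2 p1 p2,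
  @is_biproduct (Mod A) M N (M * N : lmodType A^c)%type i1 i2 p1 p2.
Proof.
have [x y|x a|i1 i1E] := @hom_exists A M (M * N : lmodType A^c)%type (fun x => (x, 0)).
- by rewrite -[0 in LHS]addr0.
- by rewrite -[0 in LHS](act0l _ a).
have [x y|x a|i2 i2E] := @hom_exists A N (M * N : lmodType A^c)%type (fun x => (0, x)).
- by rewrite -[0 in LHS]addr0.
- by rewrite -[0 in LHS](act0l _ a).
have [//|//|p1 p1E] := @hom_exists A (M * N : lmodType A^c)%type M fst.
have [//|//|p2 p2E] := @hom_exists A (M * N : lmodType A^c)%type N snd.
exists i1, i2, p1, p2; split; apply: hom_ext => x.
- by rewrite apc i1E p1E.
- by rewrite apc i2E p2E.
- by rewrite apc i2E p1E.
- by rewrite apc i1E p2E.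
- rewrite ap_add !apc i1E i2E p1E p2E; case: x => x y /=.
  by congr (_, _); rewrite ?addr0 ?add0r.
Qed.

Lemma full_sub_abelian : abelian (full_sub S).
Proof.
split.
- have [//|Z [q [qs qE]]] := @quot_exists A (regular A) (fun _ => True).
  have Z0 (z : Z) : z = 0 by have [x <-] := qs z; apply/qE.
  by exists (exist _ Z (Szero Z0)); apply/full_sub_zero/mod_is_zero.
- move=> [M SM] [N SN]; have [i1 [i2 [p1 [p2 bip]]]] := biproduct_exists M N.
  by exists (exist _ _ (Sprod SM SN)), i1, i2, p1, p2; case: bip.
- move=> [M SM] [N SN] f.
  have [K [k [ki kE]]] := sub_exists (@submodule_ker A M N f).
  exists (exist _ K (Sker SM SN ki kE)), k; apply: full_sub_kernel.
  exact: mod_is_kernel.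
- move=> [M SM] [N SN] f.
  have [Q [q [qs qE]]] := quot_exists (@submodule_im A M N f).
  (* The cokernel in the subcategory is the module cokernel followed by its reflection. *)
  have [L [r [SL rU]]] := Srefl Q.
  exists (exist _ L SL), (r \c q); split.
    by apply: hom_ext => m; rewrite !apc (qE _).2 ?ap0 //; exists m.
  move=> [W SW] g gf0; have {}gf0 : @mcomp (Mod A) M N W g f = 0 := gf0.
  have [|h hq] := factor_surj qs (f := g).
    by move=> n /qE [m <-]; rewrite -apc gf0.
  have [h' [h'r h'U]] := rU W h SW; exists h'; split.
    by rewrite -hq -h'r; apply: (@mcompA (Mod A)).
  move=> u ur; apply/h'U/(surj_hom_epi qs).
  by rewrite hq -ur; apply/esym/(@mcompA (Mod A)).
- move=> [M SM] [N SN] f fm.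
  have fi : @inj_hom A M N f.
    have [K [k [ki kE]]] := sub_exists (@submodule_ker A M N f).
    have k0 : k = 0.
      apply: (fm (exist _ K (Sker SM SN ki kE))); rewrite mcomp0r.
      by apply: hom_ext => x; rewrite apc; apply/kE; exists x.
    by move=> m /kE [x <-]; rewrite k0.
  have [Q [g [SQ gE]]] := Smono SM SN fi.
  by exists (exist _ Q SQ), g; apply/full_sub_kernel/mod_is_kernel.
- move=> [M SM] [N SN] f fe.
  have [K [k [ki kE]]] := sub_exists (@submodule_ker A M N f).
  exists (exist _ K (Sker SM SN ki kE)), k; split.
    by apply: hom_ext => x; rewrite apc; apply/kE; exists x.
  move=> [W SW] g gk0; have {}gk0 : @mcomp (Mod A) K M W g k = 0 := gk0.
  have [W' g' SW' g'f0|m /kE [x <-]|h hf] := Sepi SM SN (f := f) (g := g) _ SW.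
  + by apply: (fe (exist _ W' SW')); rewrite mcomp0l.
  + by rewrite -apc gk0.
  exists h; split=> // h' h'f; apply: (fe (exist _ W SW)).
  exact: etrans hf (esym h'f).
Qed.

End FullSubAbelian.

(** * Modules killed by the ideal *)

Section KilledAbelian.
Variables (A : pzRingType) (I : A -> Prop).
Implicit Types M N P Q K W : lmodType A^c.

Lemma killed_reflection M : exists N (r : @mor (Mod A) M N), ideal_killed I N /\
  forall W (g : @mor (Mod A) M W), ideal_killed I W ->
  exists! h : @mor (Mod A) N W, h \c r = g.
Proof.
have [Q [q [qs qE]]] := quot_exists (submodule_span I M).
exists Q, q; split; first by apply: killed_surj_span qs _ => m /qE.
move=> W g kW; have [|h hE] := factor_surj qs (f := g).
  by move=> m /qE; apply: span_killed.
by exists h; split=> // h' h'E; apply: (surj_hom_epi qs); rewrite hE.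
Qed.

Lemma killed_abelian : abelian (full_sub (@ideal_killed A I : Mod A -> Prop)).
Proof.
apply: full_sub_abelian.
- by move=> M M0 m x _; apply: M0.
- by move=> M N kM kN [m n] x Ix; congr (_, _); [apply: kM|apply: kN].
- by move=> K M N k f kM _ ki _; apply: killed_inj ki kM.
- exact: killed_reflection.
- move=> M N f kM kN fi; have [Q [q [qs qE]]] := quot_exists (submodule_im f).
  by exists Q, q; split=> //; apply: killed_surj qs kN.
- move=> M N f kM kN fe W g kW fg; apply: factor_surj => // n.
  have [Q [q [qs qE]]] := quot_exists (submodule_im f).
  apply/qE; rewrite (fe Q q) //; first exact: killed_surj qs kN.
  by apply: hom_ext => m; rewrite apc; apply/qE; exists m.
Qed.

End KilledAbelian.

(** * Local modules, their reflection and their colocal covers *)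

Section Local.
Variables (A : pzRingType) (I : A -> Prop).
Hypothesis I2 : two_sided_ideal I.
Hypothesis Iidem : forall a, ideal_mul I I a <-> I a.
Implicit Types M N P Q K W : lmodType A^c.

(** The two conditions are injectivity and surjectivity of [W -> Hom_A(I, W)]. *)
Definition ideal_local W : Prop := ideal_torsion_free I W /\
  forall f : A -> W, lin_on_ideal I f -> exists w, forall x, I x -> f x = w *> x.

(** Equivalently, the cokernel of [f] is killed by [I]. *)
Definition ideal_dense M N (f : @mor (Mod A) M N) : Prop :=
  forall n x, I x -> exists m, ap f m = n *> x.

Lemma torsion_free_eq W (v w : W) : ideal_torsion_free I W ->
  (forall x, I x -> v *> x = w *> x) -> v = w.
Proof.
by move=> tW vw; apply/subr0_eq/tW => x Ix; rewrite actBl vw // subrr.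
Qed.

Lemma ideal_prod_ind (S : A -> Prop) : S 0 ->
  (forall x y, I x -> I y -> S x -> S y -> S (x + y)) ->
  (forall x y, I x -> I y -> S (x * y)) -> forall x, I x -> S x.
Proof.
move=> S0 SD SM x /Iidem [n [y [z [yz ->]]]].
suff [] : I (\sum_(k < n) y k * z k) /\ S (\sum_(k < n) y k * z k) by [].
elim/big_rec: _ => [|k s _ [Is Ss]]; first by split=> //; apply: ideal0.
have [Iy Iz] := yz k; have Iyz : I (y k * z k) by apply: idealMr.
by split; [apply: idealD|apply: SD => //; apply: SM].
Qed.

Lemma dense_ext_unique M N W (f : @mor (Mod A) M N) (g h : @mor (Mod A) N W) :
  ideal_dense f -> ideal_torsion_free I W -> g \c f = h \c f -> g = h.
Proof.
move=> fd tW gh; apply: hom_ext => n; apply: torsion_free_eq tW _ => x Ix.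
by rewrite -!apM; have [m <-] := fd n x Ix; rewrite -!apc gh.
Qed.

(** For fixed [n], sending [x] in [I] to the value of [g] at a preimage of [n x] is well defined and
    linear on [I]; locality of [W] represents it by a unique element, which is taken as [h n]. *)
Lemma dense_ext M N W (f : @mor (Mod A) M N) (g : @mor (Mod A) M W) :
  ideal_dense f -> ideal_local W -> (forall m, ap f m = 0 -> ap g m = 0) ->
  exists h : @mor (Mod A) N W, h \c f = g.
Proof.
move=> fd [tW locW] fg.
have fgE m m' : ap f m = ap f m' -> ap g m = ap g m'.
  by move=> E; apply/subr0_eq; rewrite -apB fg // apB E subrr.
pose u n x : M := if pselect (I x) is left Ix then sval (cid (fd n x Ix)) else 0.
have uE n x : I x -> ap f (u n x) = n *> x.
  by move=> Ix; rewrite /u; case: pselect => // Ix'; case: cid.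
have hex n : exists w, forall x, I x -> ap g (u n x) = w *> x.
  apply: locW; split=> [x y Ix Iy|x a Ix].
    rewrite -apD; apply: fgE; rewrite apD !uE ?actDr //; exact: idealD.
  rewrite -apM; apply: fgE; rewrite apM !uE ?actA //; exact: idealMr.
pose h n := sval (cid (hex n)).
have hE n m x : I x -> ap f m = n *> x -> h n *> x = ap g m.
  move=> Ix fm; rewrite /h; case: cid => w /= <- //.
  by apply: fgE; rewrite uE.
have [n n'|n a|k kE] := @hom_exists A N W h.
- apply: torsion_free_eq tW _ => x Ix.
  have [[m mE] [m' m'E]] := (fd n x Ix, fd n' x Ix).
  rewrite actDl (hE n m x) // (hE n' m' x) // -apD; apply: hE => //.
  by rewrite apD mE m'E actDl.
- apply: torsion_free_eq tW _ => x Ix; have Iax := idealMl I2 a Ix.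
  have [m mE] := fd n (a * x) Iax.
  by rewrite actA (hE n m (a * x)) //; apply: hE; rewrite // mE actA.
exists k; apply: hom_ext => m; apply: torsion_free_eq tW _ => x Ix.
by rewrite apc kE -apM; apply: hE; rewrite // apM.
Qed.

Lemma local_reflection M : exists L (l : @mor (Mod A) M L),
  [/\ ideal_local L, ideal_dense l & forall m, ap l m = 0 <-> ideal_torsion I m].
Proof.
have [Q [q [qs qE]]] := quot_exists (submodule_torsion I2 M).
have tQ := torsion_free_quot Iidem qs qE.
have [H [ev [evl evD evM evS evI]]] := hom_module_exists I2 Q.
have lex m : exists h, forall x, I x -> ev h x = ap q m *> x.
  by apply: evS; split=> [x y _ _|x a _]; rewrite ?actDr ?actA.
have ev0 x : I x -> ev 0 x = 0.
  by move=> Ix; apply: (addrI (ev 0 x)); rewrite -evD // !addr0.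
have [m n|m a|l lE] := @hom_exists A M H (fun m => sval (cid (lex m))).
- case: cid => h1 /= E1; case: cid => h2 /= E2; case: cid => h3 /= E3.
  by apply: evI => x Ix; rewrite evD // E1 // E2 // E3 // apD actDl.
- case: cid => h1 /= E1; case: cid => h2 /= E2.
  apply: evI => x Ix; rewrite evM // E1 // E2 ?apM ?actA //; exact: idealMl.
have {}lE m x : I x -> ev (ap l m) x = ap q m *> x.
  by move=> Ix; rewrite lE; case: cid => h /= ->.
exists H, l; split; last 2 first.
(* Density: [h x] is the image of any lift of the value of [h] at [x], because
   [h (x y) = h(x) y]. *)
- move=> h x Ix; have [m mE] := qs (ev h x); exists m; apply: evI => y Iy.
  by rewrite lE // mE evM // (lin_onM (evl h)).
- move=> m; rewrite -qE; split=> [l0|q0]; last first.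
    by apply: evI => x Ix; rewrite lE // q0 ev0 // act0l.
  by apply: tQ => x Ix; rewrite -lE // l0 ev0.
split=> [h th|g gl].
  apply: evI => x Ix; rewrite ev0 //; apply: tQ => y Iy.
  by rewrite -(lin_onM (evl h)) // -evM // th // ev0.
(* Each [g x] is multiplication by an element of [Q]. Idempotence reduces this to a product [x y],
   where [g (x y)] is multiplication by the value of [g x] at [y]; the resulting [w], linear on [I],
   is the element of [H] representing [g]. *)
have wex x : I x -> exists w, forall y, I y -> ev (g x) y = w *> y.
  move: x; apply: ideal_prod_ind => [|x y Ix Iy [v vE] [w wE]|x y Ix Iy].
  - have g0 : g 0 = 0.
      by have I0 := ideal0 I2; apply: (addrI (g 0)); rewrite -(lin_onD gl) // !addr0.
    by exists 0 => y Iy; rewrite g0 ev0 // act0l.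
  - by exists (v + w) => z Iz; rewrite (lin_onD gl) // evD // vE // wE // actDl.
  - exists (ev (g x) y) => z Iz; rewrite (lin_onM gl) // evM //.
    exact: (lin_onM (evl _)).
pose w x : Q := if pselect (I x) is left Ix then sval (cid (wex x Ix)) else 0.
have wE x y : I x -> I y -> ev (g x) y = w x *> y.
  by move=> Ix Iy; rewrite /w; case: pselect => // Ix'; case: cid => v /= ->.
have [|h hE] := evS w.
  split=> [x y Ix Iy|x a Ix]; apply: torsion_free_eq tQ _ => z Iz.
    have Ixy := idealD I2 Ix Iy.
    by rewrite -wE // (lin_onD gl) // evD // !wE // actDl.
  have Ixa := idealMr I2 a Ix; have Iaz := idealMl I2 a Iz.
  by rewrite -wE // (lin_onM gl) // evM // wE // actA.
exists h => x Ix; apply: evI => y Iy.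
by rewrite wE // evM // (lin_onM (evl h)) // hE.
Qed.

Lemma local_abelian : abelian (full_sub (ideal_local : Mod A -> Prop)).
Proof.
(* If [n I] lies in the local submodule [M], multiplication by [n] agrees on [I] with multiplication
   by some [m] in [M], and then [n = m] since [N] is torsion-free. *)
have quot_tf M N Q (f : @mor (Mod A) M N) (q : @mor (Mod A) N Q) :
    ideal_local M -> ideal_local N -> inj_hom f -> surj_hom q ->
    (forall n, ap q n = 0 <-> exists m, ap f m = n) -> ideal_torsion_free I Q.
  move=> [tM locM] [tN _] fi qs qE y ty; have [n nE] := qs y; rewrite -nE; apply/qE.
  have nex x : I x -> exists m, ap f m = n *> x.
    by move=> Ix; apply/qE; rewrite apM nE ty.
  pose u x : M := if pselect (I x) is left Ix then sval (cid (nex x Ix)) else 0.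
  have uE x : I x -> ap f (u x) = n *> x.
    by move=> Ix; rewrite /u; case: pselect => // Ix'; case: cid.
  have [|m mE] := locM u.
    split=> [x z Ix Iz|x a Ix]; apply: (inj_homP fi).
      by rewrite apD !uE ?actDr //; apply: idealD.
    by rewrite apM !uE ?actA //; apply: idealMr.
  exists m; apply: torsion_free_eq tN _ => x Ix.
  by rewrite -apM -mE // uE.
apply: full_sub_abelian.
- move=> M M0; split=> [m _|f _]; first exact: M0.
  by exists 0 => x _; rewrite (M0 (f x)) (M0 (0 *> x)).
- move=> M N [tM locM] [tN locN]; split=> [[m n] tmn|f fl].
    by congr (_, _); [apply: tM|apply: tN] => x Ix; have [] := tmn x Ix.
  have [|m mE] := locM (fun x => (f x).1).
    by split=> *; rewrite (lin_onD fl, lin_onM fl).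
  have [|n nE] := locN (fun x => (f x).2).
    by split=> *; rewrite (lin_onD fl, lin_onM fl).
  exists (m, n) => x Ix; rewrite (surjective_pairing (f x)) mE // nE //.
- move=> K M N k f [tM locM] [tN locN] ki kE; split.
    exact: torsion_free_inj ki tM.
  move=> u ul; have [|m mE] := locM (fun x => ap k (u x)).
    by split=> *; rewrite (lin_onD ul, lin_onM ul) // (apD, apM).
  have /kE [v vE] : ap f m = 0.
    apply: tN => x Ix; rewrite -apM -mE //; apply/kE; by exists (u x).
  by exists v => x Ix; apply: (inj_homP ki); rewrite apM mE // vE.
- move=> M; have [L [l [locL ld lE]]] := local_reflection M.
  exists L, l; split=> // W g locW.
  have [m /lE tm|h hE] := dense_ext (g := g) ld locW.
    by apply: locW.1 => x Ix; rewrite -apM tm // ap0.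
  exists h; split=> // h' h'E; apply: (dense_ext_unique ld locW.1).
  by rewrite hE.
- move=> M N f locM locN fi; have [Q [q [qs qE]]] := quot_exists (submodule_im f).
  have [L [l [locL ld lE]]] := local_reflection Q.
  exists L, (l \c q); split=> // n; rewrite apc -qE; split=> [/lE|->].
    exact: (quot_tf M N Q f q).
  exact: ap0.
(* A map that is epi against local modules is dense: the reflection of its module cokernel vanishes,
   so that cokernel is torsion. *)
- move=> M N f locM locN fe W g locW fg; apply: dense_ext => // n x Ix.
  have [Q [q [qs qE]]] := quot_exists (submodule_im f).
  have [L [l [locL ld lE]]] := local_reflection Q.
  have lq0 : l \c q = 0.
    apply: fe => //; apply: hom_ext => m; rewrite !apc.
    by have /qE -> : exists m', ap f m' = ap f m; [exists m|apply: ap0].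
  have /lE tqn : ap l (ap q n) = 0 by rewrite -apc lq0.
  by apply/qE; rewrite apM tqn.
Qed.

(* [N I (x)_A I] is the largest colocal cover of [N]: maps out of it lift
   uniquely through every map with torsion kernel and cokernel. *)
Lemma colocal_cover N : exists J (e : @mor (Mod A) J N),
  [/\ ideal_dense e, forall u, ap e u = 0 -> ideal_torsion I u
    & forall P Q (f : @mor (Mod A) P Q) (g : @mor (Mod A) J Q),
        ideal_dense f -> (forall p, ap f p = 0 -> ideal_torsion I p) ->
        exists! h : @mor (Mod A) J P, f \c h = g].
Proof.
have [X [k [ki kE]]] := sub_exists (submodule_span I N).
have fullX := full_span Iidem ki kE.
have [T [t [tb tU tI]]] := tensor_exists I2 X.
have t0 x : I x -> t 0 x = 0.
  by move=> Ix; apply: (addrI (t 0 x)); rewrite -(balDl tb) // !addr0.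
have tm0 m : t m 0 = 0.
  have I0 := ideal0 I2.
  by apply: (addrI (t m 0)); rewrite -(balDr tb) // !addr0.
have [|d dE] := tU X (fun m x => m *> x).
  by split=> [m n x _|m x y _ _|m a x _|m x a _]; rewrite ?actDl ?actDr ?actA.
(* On a pure tensor, [t m x *> z = t m (x z) = t (m x) z]. Hence [I] kills the kernel of [d]. *)
have actT u z : I z -> u *> z = t (ap d u) z.
  move=> Iz; move: u; apply: tI => [|u v IHu IHv|m x Ix].
  - by rewrite act0l ap0 t0.
  - by rewrite actDl apD (balDl tb) // IHu IHv.
  - by rewrite dE // (balA tb) // (balM tb).
exists T, (k \c d); split.
- move=> n x; apply: (idem_ind Iidem (submodule_im (k \c d))) => y z Iy Iz.
  have /kE [v vE] : ideal_span I (n *> y) by apply: span_act.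
  by exists (t v z); rewrite apc dE // apM vE.
- by move=> u; rewrite apc => /ki du0 z Iz; rewrite actT // du0 t0.
move=> P Q f g fd fk.
have im_g m y : I y -> exists p, ap f p = ap g (t m y).
  move: y; apply: ideal_prod_ind => [|x y Ix Iy [p pE] [q qE]|x y Ix Iy].
  - by exists 0; rewrite tm0 !ap0.
  - by exists (p + q); rewrite (balDr tb) // !apD pE qE.
  - by rewrite (balM tb) // apM; apply: fd.
(* The wanted [h] sends [t m x] to [p *> x] for a lift [p] of [m]. Lifts exist because [X] is full:
   for [n x], a preimage under [f] of [g (t n x)] works. *)
pose lift m p := forall z, I z -> ap f (p *> z) = ap g (t m z).
have liftD m n p q : lift m p -> lift n q -> lift (m + n) (p + q).
  by move=> mp nq z Iz; rewrite actDl (balDl tb) // !apD mp // nq.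
have liftM m p a : lift m p -> lift (m *> a) (p *> a).
  by move=> mp z Iz; rewrite actA (balA tb) // mp //; apply: idealMl.
have lift_ex m : exists p, lift m p.
  apply: (fullX m (fun m => exists p, lift m p)).
    split=> [|m1 m2 [p1 P1] [p2 P2]|m1 a [p1 P1]].
    - by exists 0 => z Iz; rewrite act0l t0 // !ap0.
    - by exists (p1 + p2); apply: liftD.
    - by exists (p1 *> a); apply: liftM.
  move=> n x Ix; have [p pE] := im_g n x Ix; exists p => z Iz.
  by rewrite apM pE -apM -(balM tb) // (balA tb).
(* Multiplied by [I], the difference of two lifts falls into the torsion kernel of [f], so it is
   killed by [I I], and by idempotence by [I]. *)
have lift_eq m p q x : lift m p -> lift m q -> I x -> p *> x = q *> x.
  move=> mp mq Ix; apply/subr0_eq; rewrite -actBl; move: x Ix.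
  apply: (idem_torsion Iidem) => x y Ix Iy; apply: fk => //.
  by rewrite actBl apB mp // mq // subrr.
pose s m := sval (cid (lift_ex m)).
have sP m : lift m (s m) by rewrite /s; case: cid.
have [|h hE] := tU P (fun m x => s m *> x).
  split=> [m n x Ix|m x y _ _|m a x Ix|m x a _]; rewrite ?actDr ?actA //.
    by rewrite -actDl; apply: (lift_eq (m + n)) => //; apply: liftD.
  by rewrite -actA; apply: (lift_eq (m *> a)) => //; apply: liftM.
have fh : f \c h = g.
  apply: hom_ext => u; rewrite apc; move: u.
  apply: tI => [|u v IHu IHv|m x Ix]; first by rewrite !ap0.
    by rewrite !apD IHu IHv.
  by rewrite hE // sP.
exists h; split=> // h' fh'; apply: hom_ext => u; move: u.
apply: tI => [|u v IHu IHv|m x]; first by rewrite !ap0.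
  by rewrite !apD IHu IHv.
move: x; apply: ideal_prod_ind => [|x y Ix Iy IHx IHy|x y Ix Iy].
- by rewrite tm0 !ap0.
- by rewrite (balDr tb) // !apD IHx IHy.
rewrite (balM tb) // !apM; apply/subr0_eq; rewrite -actBl; apply: fk => //.
by rewrite apB -!apc fh fh' subrr.
Qed.

End Local.

(** * The recollement of an idempotent ideal *)

Section IdealRecollement.
Variables (A : pzRingType) (I : idempotent_ideal A).
Implicit Types M N P Q K W : lmodType A^c.
Let I2 : two_sided_ideal I := ideal_two_sided I.
Let Iidem : forall a, ideal_mul I I a <-> I a := @ideal_idem A I.
Let Killed : category := full_sub (@ideal_killed A I : Mod A -> Prop).
Let Local : category := full_sub (@ideal_local A I : Mod A -> Prop).
Let incl_killed : functor Killed (Mod A) := full_sub_incl _.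
Let incl_local : functor Local (Mod A) := full_sub_incl _.

Lemma killed_left_adjoint : exists L, left_adjoint L incl_killed.
Proof.
apply: universal_left_adjoint => M; have [Q [q [kQ qU]]] := killed_reflection I M.
by exists (exist _ Q kQ), q => -[W kW] g; apply: qU.
Qed.

Lemma killed_right_adjoint : exists R, left_adjoint incl_killed R.
Proof.
apply: universal_right_adjoint => M.
have [K [k [ki kE]]] := sub_exists (submodule_torsion I2 M).
have kK : ideal_killed I K.
  move=> u x Ix; apply: ki; rewrite apM.
  by have /kE -> : exists v, ap k v = ap k u by exists u.
exists (exist _ K kK), k => -[W kW] g; have [w|h hE] := lift_inj ki (f := g).
  by apply/kE => x Ix; rewrite -apM kW // ap0.
by exists h; split=> // h' h'E; apply: (inj_hom_mono ki);
  apply: etrans hE (esym h'E).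
Qed.

Lemma local_left_adjoint : exists L, left_adjoint L incl_local.
Proof.
apply: universal_left_adjoint => M.
have [L [l [locL ld lE]]] := local_reflection I2 Iidem M.
exists (exist _ L locL), l => -[W locW] g.
have [m /lE tm|h hE] := dense_ext I2 (g := g) ld locW.
  by apply: locW.1 => x Ix; rewrite -apM tm // ap0.
exists h; split=> // h' h'E; apply: (dense_ext_unique ld locW.1).
exact: etrans hE (esym h'E).
Qed.

Section LocalUnit.
Variables (L : functor (Mod A) Local) (eta : forall M, @mor (Mod A) M (sval (L M))).
Hypothesis etaN : forall M N (f : @mor (Mod A) M N),
  @mcomp (Mod A) M (sval (L M)) (sval (L N)) (fmap L f) (eta M) = eta N \c f.
Hypothesis etaU : forall M (W : Local), bijective (fun h : @mor Local (L M) W =>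
  @mcomp (Mod A) M (sval (L M)) (sval W) h (eta M)).

(** The left adjoint is known only by its universal property, so facts about [eta] are transported
    from the explicit reflection [l], which factors through [eta]. *)
Lemma local_unit_torsion M m : ap (eta M) m = 0 <-> ideal_torsion I m.
Proof.
have [K [l [locK ld lE]]] := local_reflection I2 Iidem M; split=> [em0|tm].
  have [psi _ psiK] := etaU M (exist _ K locK).
  by apply/lE; rewrite -(psiK l) apc em0 ap0.
by apply: (svalP (L M)).1 => x Ix; rewrite -apM tm // ap0.
Qed.

Lemma local_unit_dense M : ideal_dense I (eta M).
Proof.
move=> n x Ix; have [K [l [locK ld lE]]] := local_reflection I2 Iidem M.
have [psi _ psiK] := etaU M (exist _ K locK).
have [m /lE tm|b bE] := dense_ext I2 (g := eta M) ld (svalP (L M)).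
  exact/local_unit_torsion.
(* [b] is a retraction of the comparison map to the explicit reflection, and carries its density
   back. *)
have ba : @mcomp (Mod A) _ K _ b (psi l) = @idm (Mod A) (sval (L M)).
  apply: (bij_inj (etaU M (L M))); apply: etrans (esym (mcompA _ _ _)) _.
  by rewrite psiK bE mcomp1m.
have [m mE] := ld (@ap A (sval (L M)) K (psi l) n) x Ix.
by exists m; rewrite -bE apc mE apM -apc ba.
Qed.

Lemma local_unit_zero M : ker_functor L M <-> ideal_killed I M.
Proof.
rewrite /ker_functor (full_sub_zero (L M)) mod_is_zero; split=> [LM0 m|kM].
  by apply/local_unit_torsion; apply: LM0.
have eta0 : eta M = 0.
  by apply: hom_ext => m; apply/local_unit_torsion => x; apply: kM.
apply/mod_is_zero/is_zeroP/(bij_inj (etaU M (L M))); rewrite eta0.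
exact: etrans (mcomp0r _ _) (esym (mcomp0r _ _)).
Qed.

(** The colocal cover [e : J -> N] is dense with torsion kernel, so [eta J] extends along it to the
    universal arrow [v : N -> L J]. A map [f : N -> L Z] corresponds to the unique lift of [f e]
    through [eta Z]. *)
Lemma local_reflection_left_adjoint :
  exists J, left_adjoint J L.
Proof.
apply: universal_left_adjoint => -[N locN].
have [J [e [ed ek eU]]] := colocal_cover I2 Iidem N.
have [u /ek tu|v vE] := dense_ext I2 (g := eta J) ed (svalP (L J)).
  exact/local_unit_torsion.
exists J, v => Z f.
have [g [gE gU]] := eU Z (sval (L Z)) (eta Z)
  (@mcomp (Mod A) J N (sval (L Z)) f e) (@local_unit_dense Z)
  (fun p => (local_unit_torsion p).1).
have LgE h : @mcomp (Mod A) _ _ _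
    (@mcomp (Mod A) N (sval (L J)) (sval (L Z)) (fmap L h) v) e = eta Z \c h.
  by rewrite -mcompA vE etaN.
exists g; split=> [|h hE].
  apply: (dense_ext_unique ed (svalP (L Z)).1).
  by apply: etrans (LgE g) gE.
by apply: gU; rewrite -LgE; congr (_ \c e).
Qed.

End LocalUnit.

Lemma ideal_recollement_exists : exists R : recollement (Mod A),
  recollement_ideal R = I.
Proof.
have [iL iLadj] := killed_left_adjoint; have [iR iRadj] := killed_right_adjoint.
have [L Ladj] := local_left_adjoint.
have [eta [etaN etaU]] := left_adjoint_unit Ladj.
have [J Jadj] := local_reflection_left_adjoint etaN etaU.
have La : additive_functor L := left_adjoint_additive Ladj (@full_sub_incl_additive _ _).
have LP M := local_unit_zero etaU M.
have im_ker (M : Mod A) : ess_image incl_killed M <-> ker_functor L M.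
  rewrite LP; split=> [[[N kN]]|kM]; first by move/strict_killed; apply.
  by exists (exist _ M kM), (idm M); apply: is_iso_id.
exists (@Recollement (Mod A) Killed Local (killed_abelian I)
  (local_abelian I2 Iidem) incl_killed iL iR L J incl_local
  (@full_sub_incl_additive _ _)
  (left_adjoint_additive iLadj (@full_sub_incl_additive _ _))
  (right_adjoint_additive iRadj (@full_sub_incl_additive _ _))
  La (left_adjoint_additive Jadj La) (@full_sub_incl_additive _ _)
  Jadj Ladj iLadj iRadj (@full_sub_incl_ff _ _)
  (adjoint_triple_fully_faithful Jadj Ladj (@full_sub_incl_ff _ _))
  (@full_sub_incl_ff _ _) im_ker).
apply: idempotent_ideal_eq; rewrite -[RHS](annihilator_killed I2) /=.
by congr annihilator; apply/funext => M; apply/propext/LP.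
Qed.

End IdealRecollement.

(** * Equivalence classes of recollements and ideals *)

Section RecollementClasses.
Variable A : pzRingType.

(** A representative is chosen; by [recollement_equiv_ideal] its ideal depends on the class only. *)
Definition class_ideal (c : recollement_class (Mod A)) : idempotent_ideal A :=
  recollement_ideal (sval (cid (svalP c))).

Definition ideal_recollement (I : idempotent_ideal A) : recollement (Mod A) :=
  sval (cid (ideal_recollement_exists I)).

Lemma ideal_recollementK I : recollement_ideal (ideal_recollement I) = I.
Proof. exact: svalP (cid (ideal_recollement_exists I)). Qed.

Fact ideal_classP I : exists R, forall S,
  recollement_equiv (ideal_recollement I) S <-> recollement_equiv R S.
Proof. by exists (ideal_recollement I). Qed.

Definition ideal_class (I : idempotent_ideal A) : recollement_class (Mod A) :=
  exist _ _ (ideal_classP I).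

Lemma ideal_classK : cancel ideal_class class_ideal.
Proof.
move=> I; rewrite /class_ideal; case: cid => R RP /=.
have /RP /= /recollement_equiv_ideal : recollement_equiv R R.
  exact/recollement_equiv_ideal.
by rewrite ideal_recollementK.
Qed.

Lemma class_idealK : cancel class_ideal ideal_class.
Proof.
move=> [P PR]; apply: eq_exist; apply/funext => S; apply/propext.
rewrite /class_ideal; case: cid => R /= ->.
by rewrite !recollement_equiv_ideal ideal_recollementK.
Qed.

End RecollementClasses.

Theorem proposition5p2 (A : pzRingType) :
  (exists f : recollement_class (Mod A) -> ttf_triple (Mod A), bijective f) /\
  (exists g : ttf_triple (Mod A) -> idempotent_ideal A, bijective g).
Proof.
split; last first.
  by exists (@ttf_ideal A), (@ideal_ttf A); [exact: ttf_idealK|exact: ideal_ttfK].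
exists (@ideal_ttf A \o @class_ideal A).
by apply: bij_comp; [exists (@ttf_ideal A)|exists (@ideal_class A)];
  [exact: ideal_ttfK|exact: ttf_idealK|exact: class_idealK|exact: ideal_classK].
Qed.
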